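(* Let $c^i_{jk}(u)$ be the structure constants of an associative semisimple algebra structure on the tangent spaces of an $n$-dimensional manifold, admitting a holonomic basis of idempotents, let $X_\alpha$ ($\alpha=1,\dots,m$) be vector fields, and let $$u^i_{t_\alpha}=(W_\alpha)^i_j(u)\,u^j_x=c^i_{jk}(u)X^k_\alpha(u)\,u^j_x,\qquad \alpha=1,\dots,m,$$ be the corresponding systems of hydrodynamic type (diagonal in canonical coordinates), assumed to be pairwise commuting. Let $\epsilon_\alpha=\pm1$ and suppose that the metric $$g^{ij}=\Big(\sum_{\alpha=1}^m\epsilon_\alpha X_\alpha\otimes X_\alpha\Big)^{ij}$$ is non-degenerate and satisfies $$g^{kl}c^i_{lm}=g^{il}c^k_{lm}\quad\text{for all indices } i,k,m.$$ Then: 1. Denoting by $\nabla$ the Levi-Civita connection of $g$, for every $\alpha$ $$g_{ik}(W_\alpha)^k_j=g_{jk}(W_\alpha)^k_i,\qquad \nabla_k(W_\alpha)^i_j=\nabla_j(W_\alpha)^i_k.$$ 2. The affinors $W_\alpha$ satisfy, for all $\alpha,\beta$ and all values of the free indices, (a) $(W_\beta)^m_q\partial_m(W_\alpha)^k_l+(W_\beta)^m_l\partial_m(W_\alpha)^k_q+(W_\alpha)^k_m\partial_l(W_\beta)^m_q+(W_\alpha)^k_m\partial_q(W_\beta)^m_l=(W_\alpha)^m_q\partial_m(W_\beta)^k_l+(W_\alpha)^m_l\partial_m(W_\beta)^k_q+(W_\beta)^k_m\partial_l(W_\alpha)^m_q+(W_\beta)^k_m\partial_q(W_\alpha)^m_l$,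 (b) $[W_\alpha,W_\beta]=0$, (c) $\sum_{\alpha}\epsilon_\alpha\big((W_\alpha)^i_k(W_\alpha)^j_h-(W_\alpha)^i_h(W_\alpha)^j_k\big)=0$, and therefore the operator $$\sum_{\alpha=1}^m\epsilon_\alpha\,(W_\alpha)^i_ku^k_x\left(\frac{d}{dx}\right)^{-1}(W_\alpha)^j_hu^h_x$$ is a purely nonlocal Hamiltonian operator.
   Context: Summation over repeated Latin indices $1,\dots,n$ is understood; in the tensor identities the letter $m$ is also used as an index. $\partial_m=\partial/\partial u^m$. The algebra structure on each tangent space is $(Y\cdot Z)^i=c^i_{jk}Y^jZ^k$. It admits a holonomic basis of idempotents if there are vector fields $Z_1,\dots,Z_n$, forming a basis at each point, with $Z_i\cdot Z_j=\delta_{ij}Z_j$ and pairwise commuting as vector fields; then there are local coordinates, called canonical coordinates, in which $Z_i=\partial/\partial u^i$ and $c^i_{jk}=\delta^i_j\delta^i_k$. Two systems commute if the flows $u_{t_\alpha}=W_\alpha u_x$, $u_{t_\beta}=W_\beta u_x$ satisfy $u_{t_\alpha t_\beta}=u_{t_\beta t_\alpha}$. $g_{ij}$ is the inverse matrix of $g^{ij}$. Here $\left(\frac{d}{dx}\right)^{-1}=\frac12\int_{-\infty}^xdx-\frac12\int_x^{+\infty}dx$. An operator $P^{ij}$ of the displayed form is Hamiltonian if the bracket $\{F,G\}=\int\frac{\delta F}{\delta u^i}P^{ij}\frac{\delta G}{\delta u^j}\,dx=\iint\frac{\delta F}{\delta u^i(x)}\Pi^{ij}(x,y)\frac{\delta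 G}{\delta u^j(y)}\,dy\,dx$, with kernel $\Pi^{ij}(x,y)=\sum_\alpha\epsilon_\alpha(W_\alpha)^i_s(u(x))u^s_x\,\frac12\operatorname{sgn}(x-y)\,(W_\alpha)^j_l(u(y))u^l_y$, is skew-symmetric and satisfies the Jacobi identity, for local functionals $F,G,H$ with densities not depending on the $x$-derivatives of $u$, where $\{\{G,H\},F\}=\iint\frac{\delta\{G,H\}}{\delta u^m(t)}\Pi^{mi}(t,x)\frac{\delta F}{\delta u^i(x)}\,dx\,dt$. *)

(* Defs.v *)
From mathcomp Require Export all_boot all_order all_algebra.
From mathcomp Require Export all_classical all_reals all_analysis.
Export Order.TTheory GRing.Theory Num.Theory.
Export numFieldNormedType.Exports.

Set Implicit Arguments.
Unset Strict Implicit.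
Unset Printing Implicit Defensive.

Global Open Scope classical_set_scope.
Global Open Scope ring_scope.

(* Everything is written in one coordinate chart u^1, ..., u^n of the manifold,
   with image an open set U of R^n; the coordinates are arbitrary (in
   particular they are not assumed canonical).  Points, tangent vectors and
   covectors are row vectors.  For an affinor A, the entry [A i j] is A^i_j
   (upper index first), so that [*m] is composition of affinors. *)

Section Calculus.
Variables (R : realType) (n : nat).

Definition pd (j : 'I_n) (f : 'rV[R]_n -> R) (u : 'rV[R]_n) : R :=
  'D_(delta_mx 0 j) f u.

(* C^oo on the open set U: all iterated partial derivatives are differentiable
   (hence continuous) on U. *)
Definition smooth_on (U : set 'rV[R]_n) (f : 'rV[R]_n -> R) : Prop :=
  forall (s : seq 'I_n) (u : 'rV[R]_n), U u -> differentiable (foldr pd f s) u.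

Definition smooth_vfield (U : set 'rV[R]_n) (Y : 'rV[R]_n -> 'rV[R]_n) : Prop :=
  forall i : 'I_n, smooth_on U (fun u => Y u 0 i).

Definition lie_bracket (Y Z : 'rV[R]_n -> 'rV[R]_n) (u : 'rV[R]_n) : 'rV[R]_n :=
  \row_i \sum_j (Y u 0 j * pd j (fun v => Z v 0 i) u -
                 Z u 0 j * pd j (fun v => Y v 0 i) u).

Definition smooth_curve (u : R -> 'rV[R]_n) : Prop :=
  forall (k : nat) (x : R), derivable (derive1n k u) x 1.

End Calculus.

Section TangentAlgebra.
Variables (R : realType) (n : nat).
(* [c i j k u] is c^i_{jk}(u) *)
Variable c : 'I_n -> 'I_n -> 'I_n -> 'rV[R]_n -> R.

Definition tmul (u Y Z : 'rV[R]_n) : 'rV[R]_n :=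
  \row_i \sum_j \sum_k c i j k u * Y 0 j * Z 0 k.

Definition associative_on (U : set 'rV[R]_n) : Prop :=
  forall u, U u -> associative (tmul u).

Definition idempotent_basis (u : 'rV[R]_n) (e : 'I_n -> 'rV[R]_n) : Prop :=
  (\matrix_a e a \in unitmx) /\
  (forall a b, tmul u (e a) (e b) = if a == b then e b else 0).

(* Each algebra T_uM is isomorphic to R^n with the componentwise product; no
   regularity in u is asked of the idempotents. *)
Definition semisimple_on (U : set 'rV[R]_n) : Prop :=
  forall u, U u -> exists e, idempotent_basis u e.

Definition holonomic_idempotents (U : set 'rV[R]_n) : Prop :=
  exists Z : 'I_n -> 'rV[R]_n -> 'rV[R]_n,
    [/\ forall a, smooth_vfield U (Z a),
        forall u, U u -> idempotent_basis u (Z ^~ u) &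
        forall a b u, U u -> lie_bracket (Z a) (Z b) u = 0].

Definition affinor_of (X : 'rV[R]_n -> 'rV[R]_n) (u : 'rV[R]_n) : 'M[R]_n :=
  \matrix_(i, j) \sum_k c i j k u * X u 0 k.

End TangentAlgebra.

Section Metric.
Variables (R : realType) (n : nat).
(* The metric is given by its contravariant components, [g u i j] being
   g^{ij}(u); the covariant components g_{ij} are those of [invmx (g u)]. *)
Variable g : 'rV[R]_n -> 'M[R]_n.

(* Gamma^i_{jk} of the Levi-Civita connection of g *)
Definition christoffel (i j k : 'I_n) (u : 'rV[R]_n) : R :=
  2^-1 * \sum_l g u i l * (pd j (fun v => invmx (g v) l k) u +
                           pd k (fun v => invmx (g v) l j) u -
                           pd l (fun v => invmx (g v) j k) u).

(* nabla_k A^i_j *)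
Definition nabla (A : 'rV[R]_n -> 'M[R]_n) (k i j : 'I_n) (u : 'rV[R]_n) : R :=
  pd k (fun v => A v i j) u
  + \sum_s christoffel i k s u * A u s j
  - \sum_s christoffel s k j u * A u i s.

End Metric.

Section Flows.
Variables (R : realType) (n : nat).

Definition hydro (A : 'rV[R]_n -> 'M[R]_n) (u : R -> 'rV[R]_n) (x : R)
    : 'rV[R]_n :=
  \row_i \sum_j A (u x) i j * derive1 u x 0 j.

(* u_{t_a t_b}: the derivative of the right-hand side A(u)u_x of the first
   system when u moves with velocity u_{t_b} = B(u)u_x. *)
Definition mixed_time_derivative (A B : 'rV[R]_n -> 'M[R]_n)
    (u : R -> 'rV[R]_n) (x : R) : 'rV[R]_n :=
  derive1 (fun s : R => hydro A (fun y => u y + s *: hydro B u y) x) 0.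

Definition commuting_flows (U : set 'rV[R]_n) (A B : 'rV[R]_n -> 'M[R]_n)
    : Prop :=
  forall u : R -> 'rV[R]_n, smooth_curve u -> (forall x, U (u x)) ->
    forall x, mixed_time_derivative A B u x = mixed_time_derivative B A u x.

End Flows.

Section Hamiltonian.
Variables (R : realType) (n : nat).
Local Notation mu := (@lebesgue_measure R).

(* The phase space: smooth maps with relatively compact image in U whose
   x-derivative is bounded and integrable on the line.  It contains the maps
   with u_x rapidly decreasing, or compactly supported, and on it all the
   integrals below converge absolutely. *)
Definition phase_space (U : set 'rV[R]_n) (u : R -> 'rV[R]_n) : Prop :=
  [/\ smooth_curve u,
      exists K : set 'rV[R]_n, [/\ compact K, K `<=` U & forall x, K (u x)],
      exists M : R, forall x, `|derive1 u x| <= M &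
      mu.-integrable setT (fun x => `|derive1 u x|%:E)].

Definition test_field (v : R -> 'rV[R]_n) : Prop :=
  smooth_curve v /\ exists a : R, forall x, a < `|x| -> v x = 0.

(* [D] is the variational derivative at u of a (possibly nonlocal) functional;
   it is unique, being continuous. *)
Definition is_variational_derivative (Phi : (R -> 'rV[R]_n) -> R)
    (u D : R -> 'rV[R]_n) : Prop :=
  continuous D /\
  forall v, test_field v ->
    is_derive (0 : R) (1 : R) (fun s : R => Phi (fun x => u x + s *: v x))
      (\int[mu]_x \sum_i D x 0 i * v x 0 i).

(* delta F / delta u for F = int f(u) dx *)
Definition var_density (f : 'rV[R]_n -> R) (u : R -> 'rV[R]_n) (x : R)
    : 'rV[R]_n :=
  \row_i pd i f (u x).

(* An operator P^{ij} depending on the field: [P u xi] is P^{ij} xi_j at u. *)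
Variable P : (R -> 'rV[R]_n) -> (R -> 'rV[R]_n) -> R -> 'rV[R]_n.

Definition pairing (u xi eta : R -> 'rV[R]_n) : R :=
  \int[mu]_x \sum_i xi x 0 i * P u eta x 0 i.

Definition bracket (f g : 'rV[R]_n -> R) (u : R -> 'rV[R]_n) : R :=
  pairing u (var_density f u) (var_density g u).

Definition hamiltonian (U : set 'rV[R]_n) : Prop :=
  (forall f g u, smooth_on U f -> smooth_on U g -> phase_space U u ->
     bracket f g u = - bracket g f u) /\
  (forall f g h u,
     smooth_on U f -> smooth_on U g -> smooth_on U h -> phase_space U u ->
     exists Dgh Dhf Dfg : R -> 'rV[R]_n,
       [/\ is_variational_derivative (bracket g h) u Dgh,
           is_variational_derivative (bracket h f) u Dhf,
           is_variational_derivative (bracket f g) u Dfg &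
           pairing u Dgh (var_density f u) + pairing u Dhf (var_density g u)
           + pairing u Dfg (var_density h u) = 0]).

End Hamiltonian.

Section NonlocalOperator.
Variables (R : realType) (n m : nat).
Local Notation mu := (@lebesgue_measure R).

(* (d/dx)^{-1} *)
Definition dx_inv (f : R -> R) (x : R) : R :=
  2^-1 * (\int[mu]_(y in `]-oo, x]) f y) - 2^-1 * (\int[mu]_(y in `[x, +oo[) f y).

(* sum_a eps_a (W_a)^i_k u^k_x (d/dx)^{-1} (W_a)^j_h u^h_x *)
Definition nonlocal_operator (eps : 'I_m -> R)
    (W : 'I_m -> 'rV[R]_n -> 'M[R]_n)
    (u xi : R -> 'rV[R]_n) (x : R) : 'rV[R]_n :=
  \row_i \sum_a eps a * hydro (W a) u x 0 i *
    dx_inv (fun y => \sum_j hydro (W a) u y 0 j * xi y 0 j) x.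

End NonlocalOperator.

(* Main.v *)
(* In the frame of commuting idempotents Z_a every W_alpha is diagonal, with eigenvalues
   v_alpha^a, and commutation of the flows becomes
   (v_beta^a - v_beta^b) Z_a(v_alpha^b) = (v_alpha^a - v_alpha^b) Z_a(v_beta^b).
   Summing against epsilon_beta v_beta^b, where sum_alpha epsilon_alpha v_alpha^a v_alpha^b
   is the (diagonal) metric, identifies Z_a(v_alpha^b) with a Christoffel coefficient times
   v_alpha^a - v_alpha^b, which is the symmetry of the covariant derivative of W_alpha.
   Identity (2a) is the polarization in u_x of the second-order part of the commutation
   relation, tested on curves with prescribed velocity Y at u0; (2c) follows from
   associativity and the symmetry of g.

   With om_alpha^f = sum_{i,k} d_i f (W_alpha)^i_k u^k_x, the bracket of f and g is
   sum_alpha epsilon_alpha B(om_alpha^f, om_alpha^g) for the form B with kernel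
   sgn(x-y)/2, which is skew (Fubini) and bounded in the L^1 norm; so its variational
   derivative is that of a bounded bilinear form.  The local terms vanish by (2c).  What
   remains of the Jacobi identity is a sum of the numbers
   d(om_alpha^f)(W_beta u_x, u_x), which are symmetric in alpha and beta by (2a), (2b) and
   the symmetry of the Hessian of f, so that the terms cancel in pairs. *)

(* No canonical coordinates are introduced: the chart stays arbitrary and the commuting idempotent
   fields serve as a frame, in which the bracket terms of Koszul's formula vanish. Covariant
   derivatives are therefore handled as componentwise derivatives along frame vectors plus a
   Christoffel term. Three points shape the analysis. Commutation of flows is given only along
   curves defined on the whole line and staying in [U], so the test curves are sinusoids of small
   amplitude and high frequency instead of straight lines. The variation of om along a test field v
   is the x-derivative of a one-form on v plus an exterior derivative on (v, u_x): integrating the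
   first summand by parts produces the local terms, the second one the nonlocal gradient. Finally,
   the Jacobi identity contracts this gradient, which already contains u_x, with W u_x; the result
   is quadratic in u_x and integrable because [phase_space] asks u_x to be bounded as well as
   integrable. All antiderivatives are then taken at the same x, so the Jacobi terms cancel inside
   the integrand. *)
Require Import Defs.
From mathcomp Require Import ring lra measurable_realfun.

Set Implicit Arguments.
Unset Strict Implicit.
Unset Printing Implicit Defensive.

(** * Partial derivatives *)
Section PartialDerivatives.
Variables (R : realType) (n : nat).
Implicit Types (f g : 'rV[R]_n -> R) (u w : 'rV[R]_n) (U : set 'rV[R]_n).

Lemma pdD j f g u : differentiable f u -> differentiable g u ->
  pd j (fun v => f v + g v) u = pd j f u + pd j g u.
Proof.
by move=> df dg; rewrite -[LHS]/('D__ (f + g) _) deriveD //; exact: diff_derivable.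
Qed.

Lemma pdM j f g u : differentiable f u -> differentiable g u ->
  pd j (fun v => f v * g v) u = pd j f u * g u + f u * pd j g u.
Proof.
move=> df dg; rewrite -[LHS]/('D__ (f * g) _).
rewrite deriveM; [|exact: diff_derivable..].
by rewrite addrC; congr (_ + _); exact: mulrC.
Qed.

Lemma pd_cst j (a : R) u : pd j (fun=> a) u = 0.
Proof. exact: derive_cst. Qed.

Lemma pd_near j f g u : (\near u, f u = g u) -> pd j f u = pd j g u.
Proof. exact: near_eq_derive. Qed.

Lemma open_eq_pd U j f g u :
  open U -> U u -> (forall v, U v -> f v = g v) -> pd j f u = pd j g u.
Proof.
move=> oU Uu fg; apply: pd_near; have UN : nbhs u U by exact: open_nbhs_nbhs.
exact: (filterS fg UN).
Qed.

Lemma diff_pd f u w :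
  differentiable f u -> 'd f u w = \sum_l w 0 l * pd l f u.
Proof.
move=> df; rewrite {1}[w]row_sum_delta linear_sum.
by apply: eq_bigr => l _; rewrite linearZ -deriveE.
Qed.

Lemma is_derive_curve f (c : R -> 'rV[R]_n) t w :
  differentiable f (c t) -> is_derive t 1 c w ->
  is_derive t (1 : R) (fun s => f (c s)) (\sum_l w 0 l * pd l f (c t)).
Proof.
move=> df dc; have dc' : differentiable c t by apply/derivable1_diffP/ex_derive.
have dfc : differentiable (f \o c) t by apply: differentiable_comp.
apply: DeriveDef; first exact/derivable1_diffP.
rewrite deriveE // diff_comp //= -(diff_pd _ df); congr ('d f _ _).
by rewrite -deriveE // derive_val.
Qed.

End PartialDerivatives.

(** * Functions of class C^1 on an open set *)
Section ClassC1.
Variables (R : realType) (n : nat) (U : set 'rV[R]_n).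
Hypothesis oU : open U.
Implicit Types (f g : 'rV[R]_n -> R).

(** First order is all that the entries of W and the pulled-back differentials are asked for.
    Closure under sums and products then takes a single use of Leibniz, where [smooth_on] would
    require it for all iterated derivatives. *)
Definition C1_on f := forall u, U u ->
  differentiable f u /\ forall j, {for u, continuous (pd j f)}.

Lemma smooth_C1 f : smooth_on U f -> C1_on f.
Proof.
move=> sf u Uu; split=> [|j]; first exact: (sf [::]).
exact/differentiable_continuous/(sf [:: j]).
Qed.

Lemma smooth_pd f i : smooth_on U f -> smooth_on U (pd i f).
Proof. by move=> sf s u Uu; have := sf (rcons s i) u Uu; rewrite foldr_rcons. Qed.

Lemma C1_diff f u : C1_on f -> U u -> differentiable f u.
Proof. by move=> cf /cf[]. Qed.

Lemma C1_cont f u : C1_on f -> U u -> {for u, continuous f}.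
Proof. by move=> cf Uu; apply/differentiable_continuous/C1_diff. Qed.

Lemma continuous_for_open f g u :
  U u -> (forall v, U v -> f v = g v) -> {for u, continuous f} -> {for u, continuous g}.
Proof.
move=> Uu fg cf; rewrite /prop_for /continuous_at -(fg u Uu).
apply: cvg_trans cf; apply: (@near_eq_cvg _ _ (nbhs u)).
have UN : nbhs u U by exact: open_nbhs_nbhs.
exact: (filterS fg UN).
Qed.

Lemma C1_cst (a : R) : C1_on (fun=> a).
Proof.
move=> u Uu; split=> [|j]; first exact: differentiable_cst.
have -> : pd j (fun=> a) = fun=> 0 by apply/funext => v; exact: pd_cst.
exact: cst_continuous.
Qed.

Lemma C1_add f g : C1_on f -> C1_on g -> C1_on (fun v => f v + g v).
Proof.
move=> cf cg u Uu; split=> [|j].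
  by apply: differentiableD; apply: C1_diff.
apply: (@continuous_for_open (fun v => pd j f v + pd j g v)) => //.
  by move=> v Uv; rewrite pdD //; apply: C1_diff.
by apply: continuousD; [have [_] := cf u Uu | have [_] := cg u Uu]; exact.
Qed.

Lemma C1_mul f g : C1_on f -> C1_on g -> C1_on (fun v => f v * g v).
Proof.
move=> cf cg u Uu; split=> [|j].
  by apply: differentiableM; apply: C1_diff.
apply: (@continuous_for_open (fun v => pd j f v * g v + f v * pd j g v)) => //.
  by move=> v Uv; rewrite pdM //; apply: C1_diff.
have cfj := (cf u Uu).2 j; have cgj := (cg u Uu).2 j.
exact: (continuousD (continuousM cfj (C1_cont cg Uu))
                    (continuousM (C1_cont cf Uu) cgj)).
Qed.

Lemma C1_sum p (F : 'I_p -> 'rV[R]_n -> R) :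
  (forall i, C1_on (F i)) -> C1_on (fun v => \sum_i F i v).
Proof.
move=> cF; elim: p F cF => [|p IH] F cF.
  have -> : (fun v => \sum_(i < 0) F i v) = fun=> 0.
    by apply/funext => v; rewrite big_ord0.
  exact: C1_cst.
have -> : (fun v => \sum_(i < p.+1) F i v) =
    (fun v => F ord0 v + \sum_(i < p) F (lift ord0 i) v).
  by apply/funext => v; rewrite big_ord_recl.
by apply: C1_add => //; apply: IH.
Qed.

End ClassC1.

(** * Symmetry of second derivatives *)
Section Schwarz.
Variables (R : realType) (n : nat).

Lemma is_derive_line (V : normedModType R) (u v : V) (t : R) :
  is_derive t (1 : R) (fun s : R => u + s *: v) v.
Proof.
have dv : differentiable (fun s : R => s *: v) t.
  exact: differentiableZl.
have dl : is_derive t (1 : R) (fun s : R => s *: v) v.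
  apply: DeriveDef; first exact/derivable1_diffP.
  by rewrite deriveE // diffZl //= diff_val /= scale1r.
by apply: is_derive_eq (is_deriveD (is_derive_cst u t 1) dl) _; rewrite add0r.
Qed.

Lemma line_derive (f : 'rV[R]_n -> R) (i : 'I_n) (u : 'rV[R]_n) (t : R) :
  differentiable f (u + t *: delta_mx 0 i) ->
  is_derive t (1 : R) (fun s : R => f (u + s *: delta_mx 0 i))
    (pd i f (u + t *: delta_mx 0 i)).
Proof.
move=> df.
have dc : is_derive t (1 : R) (fun s : R => u + s *: delta_mx 0 i) (delta_mx 0 i : 'rV[R]_n).
  apply: (is_derive_line u (delta_mx 0 i) t).
apply: is_derive_eq (is_derive_curve df dc) _.
rewrite (bigD1 i) //= big1 ?addr0; first by rewrite mxE !eqxx mul1r.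
by move=> l /negPf li; rewrite mxE li andbF mul0r.
Qed.



(** Two uses of the mean value theorem: in direction i on the difference [phi] of two parallel
    segments, then in direction j on [pd i f]. The second difference itself does not depend on the
    order of i and j, which is what [pd_sym] exploits. *)
Lemma second_difference (U : set 'rV[R]_n) (f : 'rV[R]_n -> R) (i j : 'I_n)
    (u : 'rV[R]_n) (h : R) : smooth_on U f -> 0 < h ->
  (forall s t : R, 0 <= s <= h -> 0 <= t <= h ->
     U (u + s *: delta_mx 0 i + t *: delta_mx 0 j)) ->
  exists s t : R, [/\ 0 <= s <= h, 0 <= t <= h &
    f (u + h *: delta_mx 0 i + h *: delta_mx 0 j) - f (u + h *: delta_mx 0 i)
    - f (u + h *: delta_mx 0 j) + f u =
    h ^+ 2 * pd j (pd i f) (u + s *: delta_mx 0 i + t *: delta_mx 0 j)].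
Proof.
move=> sf h0 HU; set ei : 'rV[R]_n := delta_mx 0 i; set ej : 'rV[R]_n := delta_mx 0 j.
have hh : 0 <= h <= h by rewrite lexx ltW.
have h00 : (0 : R) <= 0 <= h by rewrite lexx ltW.
have HUi s : 0 <= s <= h -> U (u + s *: ei).
  by move=> sh; have := HU s 0 sh h00; rewrite scale0r addr0.
pose phi s := f (u + h *: ej + s *: ei) - f (u + s *: ei).
pose dphi s := pd i f (u + h *: ej + s *: ei) - pd i f (u + s *: ei).
have dphiP s : 0 <= s <= h -> is_derive s (1 : R) phi (dphi s).
  move=> sh; apply: is_deriveB; apply: line_derive; apply: (sf [::]) => //.
    by rewrite addrAC; apply: HU.
  exact: HUi.
have [||s] := @MVT_segment R phi dphi 0 h (ltW h0).
- by move=> s; rewrite in_itv => /andP[/ltW ? /ltW ?]; apply: dphiP; apply/andP.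
- apply: derivable_within_continuous => s; rewrite in_itv => sh.
  by apply: ex_derive; apply: dphiP.
rewrite in_itv /= subr0 => sh phiE.
pose psi t := pd i f (u + s *: ei + t *: ej).
pose dpsi t := pd j (pd i f) (u + s *: ei + t *: ej).
have dpsiP t : 0 <= t <= h -> is_derive t (1 : R) psi (dpsi t).
  by move=> th; apply: line_derive; apply: (sf [:: i]); apply: HU.
have [||t] := @MVT_segment R psi dpsi 0 h (ltW h0).
- by move=> t; rewrite in_itv => /andP[/ltW ? /ltW ?]; apply: dpsiP; apply/andP.
- apply: derivable_within_continuous => t; rewrite in_itv => th.
  by apply: ex_derive; apply: dpsiP.
rewrite in_itv /= subr0 => th psiE; exists s, t; split=> //.
have -> : f (u + h *: ei + h *: ej) - f (u + h *: ei) - f (u + h *: ej) + f u =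
    phi h - phi 0.
  rewrite /phi scale0r !addr0 [u + h *: ei + _]addrAC.
  ring.
rewrite phiE /dphi [u + h *: ej + _]addrAC.
move: psiE; rewrite /psi scale0r addr0 => ->.
rewrite /dpsi; ring.
Qed.

Lemma dist_half (e x y z : R) :
  `|y - z| < e / 2 -> `|x - z| < e / 2 -> `|x - y| <= e.
Proof. by rewrite !ltr_norml ler_norml => /andP[? ?] /andP[? ?]; lra. Qed.

Lemma pd_sym (U : set 'rV[R]_n) (f : 'rV[R]_n -> R) (i j : 'I_n) (u : 'rV[R]_n) :
  open U -> smooth_on U f -> U u -> pd i (pd j f) u = pd j (pd i f) u.
Proof.
move=> oU sf Uu; apply/eqP; rewrite -subr_eq0 -normr_le0; apply/ler_addgt0Pl => e e0.
rewrite addr0.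
have e2 : 0 < e / 2 by rewrite divr_gt0.
have cont k l : \forall v \near u, `|pd k (pd l f) u - pd k (pd l f) v| < e / 2.
  have /differentiable_continuous : differentiable (pd k (pd l f)) u by apply: (sf [:: k; l]).
  by move/cvgrPdist_lt => /(_ _ e2).
have UN : nbhs u U by exact: open_nbhs_nbhs.
have /nbhs_ballP[d /= d0 dP] : nbhs u (U `&` ([set v | `|pd i (pd j f) u - pd i (pd j f) v| < e / 2] `&` [set v | `|pd j (pd i f) u - pd j (pd i f) v| < e / 2])).
  exact: filterI UN (filterI (cont i j) (cont j i)).
(* A point of the square of side h is at distance at most 2h from u, hence inside the ball of radius
   d. *)
pose h := d / 3.
have h0 : 0 < h by rewrite divr_gt0.
have inball k l (s t : R) : 0 <= s <= h -> 0 <= t <= h ->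
    ball u d (u + s *: delta_mx 0 k + t *: delta_mx 0 l).
  move=> /andP[s0 sh] /andP[t0 th]; rewrite -ball_normE /ball_ /=.
  have nd p : `|delta_mx 0 p : 'rV[R]_n| <= 1.
    rewrite [leLHS]mx_normrE; apply: bigmax_le => // -[a b] _; rewrite mxE /=.
    by case: (_ && _); rewrite ?normr1 ?normr0.
  rewrite -addrA opprD addNKr normrN.
  have le1 p r : 0 <= r -> `|r *: (delta_mx 0 p : 'rV[R]_n)| <= r.
    by move=> r0; rewrite normrZ ger0_norm // ler_piMr.
  apply: le_lt_trans (ler_normD _ _) _.
  apply: le_lt_trans (lerD (le1 k _ s0) (le1 l _ t0)) _.
  by move: sh th d0; rewrite /h; lra.
have [s [t [s0 t0 E1]]] := @second_difference U f i j u h sf h0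
  (fun s t hs ht => (dP _ (inball i j s t hs ht)).1).
have [s' [t' [s0' t0' E2]]] := @second_difference U f j i u h sf h0
  (fun s t hs ht => (dP _ (inball j i s t hs ht)).1).
(* Both mean value points compute the same second difference, so the two mixed derivatives take a
   common value, each within e / 2 of its value at u. *)
have EE : pd j (pd i f) (u + s *: delta_mx 0 i + t *: delta_mx 0 j) =
    pd i (pd j f) (u + s' *: delta_mx 0 j + t' *: delta_mx 0 i).
  have h2 : h ^+ 2 != 0 by rewrite expf_neq0 // gt_eqF.
  apply: (mulfI h2); apply: etrans (esym E1) _; apply: etrans _ E2.
  have E3 : u + h *: delta_mx 0 i + h *: delta_mx 0 j =
      u + h *: delta_mx 0 j + h *: delta_mx 0 i by rewrite addrAC.
  rewrite E3; move: (f _) (f (u + _)) (f (u + _)) (f u) => x1 x2 x3 x4.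
  by rewrite (addrAC x1).
have [_ [_ A1]] := dP _ (inball i j s t s0 t0).
have [_ [A2 _]] := dP _ (inball j i s' t' s0' t0').
have {}A1 := A1 : `|_ - _| < _; have {}A2 := A2 : `|_ - _| < _.
rewrite -EE in A2.
exact: dist_half A1 A2.
Qed.

End Schwarz.

(** * The algebra on a tangent space *)
Section TangentAlgebraTheory.
Variables (R : realType) (n : nat).
Variable c : 'I_n -> 'I_n -> 'I_n -> 'rV[R]_n -> R.
Variable u : 'rV[R]_n.
Local Notation "Y ** Z" := (tmul c u Y Z) (at level 40).

Lemma tmul_suml p (s : 'I_p -> R) (e : 'I_p -> 'rV[R]_n) Z :
  (\sum_a s a *: e a) ** Z = \sum_a s a *: (e a ** Z).
Proof.
apply/rowP => i; rewrite summxE !mxE.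
under [RHS]eq_bigr do rewrite !mxE mulr_sumr.
rewrite [RHS]exchange_big /=; apply: eq_bigr => j _.
under [RHS]eq_bigr do rewrite mulr_sumr.
rewrite [RHS]exchange_big /=; apply: eq_bigr => k _.
rewrite summxE mulr_sumr mulr_suml; apply: eq_bigr => a _.
by rewrite [(s a *: e a) 0 j]mxE; ring.
Qed.

Lemma tmul_sumr p (s : 'I_p -> R) (e : 'I_p -> 'rV[R]_n) Y :
  Y ** (\sum_a s a *: e a) = \sum_a s a *: (Y ** e a).
Proof.
apply/rowP => i; rewrite summxE !mxE.
under [RHS]eq_bigr do rewrite !mxE mulr_sumr.
rewrite [RHS]exchange_big /=; apply: eq_bigr => j _.
under [RHS]eq_bigr do rewrite mulr_sumr.
rewrite [RHS]exchange_big /=; apply: eq_bigr => k _.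
rewrite summxE mulr_sumr; apply: eq_bigr => a _.
by rewrite !mxE mulrCA.
Qed.

Lemma tmul_delta i j k :
  (delta_mx 0 j ** delta_mx 0 k) 0 i = c i j k u.
Proof.
rewrite mxE (bigD1 j) //= [X in _ + X]big1 ?addr0; last first.
  by move=> l /negPf lj; rewrite big1 // => m _; rewrite !mxE lj andbF mulr0 mul0r.
rewrite (bigD1 k) //= [X in _ + X]big1 ?addr0; last first.
  by move=> l /negPf lk; rewrite [delta_mx 0 k _ _]mxE lk andbF mulr0.
by rewrite !mxE !eqxx !mulr1.
Qed.

Section Affinor.
Variable X : 'rV[R]_n -> 'rV[R]_n.

(** Vectors are rows, so an affinor W acts by [Y *m W^T]; here it is multiplication by X in the
    tangent algebra. This convention is used throughout. *)
Lemma affinor_tmul Y : Y *m (affinor_of c X u)^T = Y ** X u.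
Proof.
apply/rowP => i; rewrite !mxE; apply: eq_bigr => j _.
by rewrite !mxE mulr_sumr; apply: eq_bigr => k _; rewrite mulrA [Y 0 j * _]mulrC.
Qed.

Lemma affinor_tmul_col Y : affinor_of c X u *m Y^T = (Y ** X u)^T.
Proof. by rewrite -affinor_tmul trmx_mul trmxK. Qed.

Variable g : 'M[R]_n.
Hypotheses (gT : g^T = g) (gU : g \in unitmx).
Hypothesis gc : forall i k p, \sum_l g k l * c i l p u = \sum_l g i l * c k l p u.

(** Contraction of the compatibility condition [gc] with X in its last index. *)
Lemma affinor_mul_metric_sym : (affinor_of c X u *m g)^T = affinor_of c X u *m g.
Proof.
apply/matrixP => k i; rewrite !mxE.
have swap (a b : 'I_n) : \sum_j affinor_of c X u a j * g j b =
    \sum_p (\sum_l g b l * c a l p u) * X u 0 p.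
  under eq_bigr => j _ do rewrite mxE mulr_suml.
  rewrite exchange_big /=; apply: eq_bigr => p _; rewrite mulr_suml.
  apply: eq_bigr => l _; have -> : g l b = g b l by rewrite -{1}gT mxE.
  by ring.
by rewrite !swap; apply: eq_bigr => p _; rewrite gc.
Qed.

Lemma metric_mul_affinor_sym :
  (affinor_of c X u)^T *m invmx g = invmx g *m affinor_of c X u.
Proof.
have := affinor_mul_metric_sym; set W := affinor_of c X u => H.
rewrite trmx_mul gT in H.
have {1}-> : W^T = invmx g *m (W *m g) by rewrite -H mulKmx.
by rewrite -!mulmxA mulmxV // mulmx1.
Qed.

End Affinor.

Section Commutative.
Variable e : 'I_n -> 'rV[R]_n.
Hypothesis eP : idempotent_basis c u e.
Let E := \matrix_a e a.

Lemma frame_coord (Y : 'rV[R]_n) : exists s : 'I_n -> R, Y = \sum_a s a *: e a.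
Proof.
have [EU _] := eP; exists (fun a => (Y *m invmx E) 0 a).
rewrite -[LHS](mulmxKV EU) mulmx_sum_row; apply: eq_bigr => a _.
by rewrite rowK.
Qed.

Lemma tmul_coord (s t : 'I_n -> R) :
  (\sum_a s a *: e a) ** (\sum_a t a *: e a) = \sum_a (s a * t a) *: e a.
Proof.
have [_ eM] := eP.
rewrite tmul_suml; apply: eq_bigr => a _; rewrite tmul_sumr -scalerA; congr (_ *: _).
rewrite (bigD1 a) //= big1 ?addr0 ?eM ?eqxx // => b ba.
by rewrite eM eq_sym (negPf ba) scaler0.
Qed.

(** In idempotent coordinates the product is componentwise. *)
Lemma tmulC Y Z : Y ** Z = Z ** Y.
Proof.
have [s ->] := frame_coord Y; have [t ->] := frame_coord Z.
by rewrite !tmul_coord; apply: eq_bigr => a _; rewrite mulrC.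
Qed.

Lemma tmulA Y Z T : Y ** (Z ** T) = (Y ** Z) ** T.
Proof.
have [s ->] := frame_coord Y; have [t ->] := frame_coord Z; have [r ->] := frame_coord T.
by rewrite !tmul_coord; apply: eq_bigr => a _; rewrite mulrA.
Qed.

Lemma affinors_commute X X' :
  affinor_of c X u *m affinor_of c X' u = affinor_of c X' u *m affinor_of c X u.
Proof.
apply: trmx_inj; apply/row_matrixP => i; rewrite !rowE !trmx_mul !mulmxA !affinor_tmul.
by rewrite -!tmulA [X u ** _]tmulC.
Qed.

(** Multiplication by [e a] is self-adjoint for the metric, so pairing [e a] = [e a ** e a] with
    [e b] equals pairing [e a] with [e a ** e b] = 0. *)
Lemma frame_orthogonal (g : 'M[R]_n) a b :
  g^T = g -> g \in unitmx ->
  (forall i k p, \sum_l g k l * c i l p u = \sum_l g i l * c k l p u) ->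
  a != b -> e a *m invmx g *m (e b)^T = 0.
Proof.
move=> gT gU gc ab; have [_ eM] := eP.
have := metric_mul_affinor_sym (fun=> e a) gT gU gc => H.
have := congr1 (fun M => e a *m M *m (e b)^T) H; rewrite !mulmxA affinor_tmul.
by rewrite -!mulmxA affinor_tmul_col !eM eqxx eq_sym (negPf ab) trmx0 !mulmx0 => ->.
Qed.

Lemma affinor_frame X (s : 'I_n -> R) b :
  X u = \sum_a s a *: e a -> e b *m (affinor_of c X u)^T = s b *: e b.
Proof.
have [_ eM] := eP => XE; rewrite affinor_tmul XE.
rewrite tmul_sumr (bigD1 b) //= big1 ?addr0 ?eM ?eqxx // => a ab.
by rewrite eM eq_sym (negPf ab) scaler0.
Qed.

(** The sum over a of eps W^i_k W^j_h is c^i_{kp} g^{pq} c^j_{hq}; compatibility of g turns it into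
    g^{jq} times the i-th component of a triple product of the basis vectors k, q, h, which is
    symmetric in k and h because the algebra is commutative and associative. *)
Lemma affinor_bivector m (eps : 'I_m -> R) (X : 'I_m -> 'rV[R]_n -> 'rV[R]_n)
    (g := \sum_(a < m) eps a *: ((X a u)^T *m X a u))
    (W := fun a => affinor_of c (X a) u) i j k h :
  g^T = g ->
  (forall i k p, \sum_l g k l * c i l p u = \sum_l g i l * c k l p u) ->
  \sum_a eps a * (W a i k * W a j h - W a i h * W a j k) = 0.
Proof.
move=> gT gc.
have gE p q : g p q = \sum_a eps a * (X a u 0 p * X a u 0 q).
  by rewrite /g summxE; apply: eq_bigr => a _; rewrite !mxE big_ord1 !mxE.
have S k' h' : \sum_a eps a * (W a i k' * W a j h') =
    \sum_q g j q * (delta_mx 0 k' ** (delta_mx 0 q ** delta_mx 0 h')) 0 i.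
  transitivity (\sum_p c i k' p u * \sum_q g p q * c j h' q u).
    under [RHS]eq_bigr => p _.
      rewrite mulr_sumr; under eq_bigr => q _ do rewrite gE mulr_suml mulr_sumr.
      rewrite exchange_big /=; over.
    rewrite [RHS]exchange_big /=; apply: eq_bigr => a _.
    rewrite /W !mxE mulr_suml mulr_sumr; apply: eq_bigr => p _.
    rewrite mulr_sumr mulr_sumr; apply: eq_bigr => q _.
    by ring.
  (* Commutativity moves the summation index q to the slot where [gc] can exchange the indices p and
     j. *)
  under eq_bigr => p _.
    under eq_bigr => q _ do rewrite -tmul_delta tmulC tmul_delta.
    rewrite gc mulr_sumr; over.
  rewrite exchange_big /=; apply: eq_bigr => q _.
  have tmul_expand Y T : Y ** T = \sum_p T 0 p *: (Y ** delta_mx 0 p).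
    by rewrite {1}[T]row_sum_delta tmul_sumr.
  rewrite [in RHS](tmul_expand (delta_mx 0 k') _) [X in _ = _ * X]summxE mulr_sumr.
  by apply: eq_bigr => p _; rewrite [in RHS]mxE !tmul_delta; ring.
under eq_bigr do rewrite mulrBr.
rewrite sumrB !S; apply/eqP; rewrite subr_eq0; apply/eqP.
apply: eq_bigr => q _; congr (_ * _ 0 i).
by rewrite [delta_mx 0 q ** _]tmulC !tmulA [delta_mx 0 k ** _]tmulC -!tmulA
  [delta_mx 0 k ** _]tmulC tmulA.
Qed.

End Commutative.
End TangentAlgebraTheory.

(** * Directional derivatives of matrix-valued maps *)
Section PartiallyDerivable.
Variables (R : realType) (n : nat).
Implicit Types (f g : 'rV[R]_n -> R) (u : 'rV[R]_n).

(** Existence of partial derivatives is what the product rule for [pd] needs, and it passes directly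
    to determinants, cofactors and inverses, hence to the covariant metric and to the
    eigenvalues. *)
Definition pderivable f u := forall j : 'I_n, derivable f u (delta_mx 0 j).

Lemma diff_pderivable f u : differentiable f u -> pderivable f u.
Proof. by move=> df j; exact: diff_derivable. Qed.

Lemma pderivable_cst (a : R) u : pderivable (fun=> a) u.
Proof. by move=> j; exact: derivable_cst. Qed.

Lemma pderivableD f g u : pderivable f u -> pderivable g u ->
  pderivable (fun v => f v + g v) u.
Proof. by move=> df dg j; exact: (derivableD (df j) (dg j)). Qed.

Lemma pderivableM f g u : pderivable f u -> pderivable g u ->
  pderivable (fun v => f v * g v) u.
Proof. by move=> df dg j; exact: (derivableM (df j) (dg j)). Qed.

Lemma pderivableV f u : f u != 0 -> pderivable f u ->
  pderivable (fun v => (f v)^-1) u.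
Proof. by move=> f0 df j; exact: (derivableV f0 (df j)). Qed.

Lemma pderivable_sum (I : Type) (r : seq I) (P : pred I) (F : I -> 'rV[R]_n -> R) u :
  (forall i, pderivable (F i) u) ->
  pderivable (fun v => \sum_(i <- r | P i) F i v) u.
Proof.
move=> dF; elim: r => [|i r IH].
  have -> : (fun v => \sum_(i <- [::] | P i) F i v) = fun=> 0.
    by apply/funext => v; rewrite big_nil.
  exact: pderivable_cst.
have -> : (fun v => \sum_(j <- i :: r | P j) F j v) =
    (fun v => (if P i then F i v else 0) + \sum_(j <- r | P j) F j v).
  by apply/funext => v; rewrite big_cons; case: ifP => //; rewrite add0r.
apply: pderivableD => //; case: (P i); [exact: dF | exact: pderivable_cst].
Qed.

Lemma pderivable_prod (I : Type) (r : seq I) (F : I -> 'rV[R]_n -> R) u :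
  (forall i, pderivable (F i) u) ->
  pderivable (fun v => \prod_(i <- r) F i v) u.
Proof.
move=> dF; elim: r => [|i r IH].
  have -> : (fun v => \prod_(i <- [::]) F i v) = fun=> 1.
    by apply/funext => v; rewrite big_nil.
  exact: pderivable_cst.
have -> : (fun v => \prod_(j <- i :: r) F j v) =
    (fun v => F i v * \prod_(j <- r) F j v).
  by apply/funext => v; rewrite big_cons.
exact: pderivableM.
Qed.

Lemma pderivable_det k (A : 'rV[R]_n -> 'M[R]_k) u :
  (forall i j, pderivable (fun v => A v i j) u) ->
  pderivable (fun v => \det (A v)) u.
Proof.
move=> dA; apply: pderivable_sum => s; apply: pderivableM; first exact: pderivable_cst.
exact: pderivable_prod.
Qed.

Lemma pderivable_adj k (A : 'rV[R]_n -> 'M[R]_k) u i j :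
  (forall i j, pderivable (fun v => A v i j) u) ->
  pderivable (fun v => (\adj (A v)) i j) u.
Proof.
move=> dA.
have -> : (fun v => (\adj (A v)) i j) =
    (fun v => (-1) ^+ (j + i) * \det (row' j (col' i (A v)))).
  by apply/funext => v; rewrite mxE.
apply: pderivableM; first exact: pderivable_cst.
apply: pderivable_det => a b.
have -> : (fun v => row' j (col' i (A v)) a b) = (fun v => A v (lift j a) (lift i b)).
  by apply/funext => v; rewrite !mxE.
exact: dA.
Qed.

(** Cramer's formula. It agrees with [invmx] only where the matrix is invertible, since [invmx] has
    a default value elsewhere; openness of U makes the agreement hold near u. *)
Lemma pderivable_invmx (U : set 'rV[R]_n) k (A : 'rV[R]_n -> 'M[R]_k) u i j :
  open U -> U u -> (forall v, U v -> A v \in unitmx) ->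
  (forall i j, pderivable (fun v => A v i j) u) ->
  pderivable (fun v => invmx (A v) i j) u.
Proof.
move=> oU Uu AU dA l.
pose F v := (\det (A v))^-1 * (\adj (A v)) i j.
apply: (@near_eq_derivable _ _ _ F).
  have UN : nbhs u U by exact: open_nbhs_nbhs.
  have FE v : U v -> F v = invmx (A v) i j by move=> Uv; rewrite /invmx AU // mxE.
  exact: (filterS FE UN).
suff : pderivable F u by exact.
apply: pderivableM; last exact: pderivable_adj.
by apply: pderivableV; [rewrite -unitfE -unitmxE AU | exact: pderivable_det].
Qed.

Lemma pd_mul j f g u : pderivable f u -> pderivable g u ->
  pd j (fun v => f v * g v) u = pd j f u * g u + f u * pd j g u.
Proof.
move=> df dg; rewrite -[LHS]/('D__ (f * g) _).
rewrite deriveM //.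
by rewrite addrC; congr (_ + _); exact: mulrC.
Qed.

Lemma pd_bigsum j p (F : 'I_p -> 'rV[R]_n -> R) u :
  (forall i, pderivable (F i) u) ->
  pd j (fun v => \sum_i F i v) u = \sum_i pd j (F i) u.
Proof.
move=> dF; have -> : (fun v => \sum_i F i v) = \sum_i F i.
  by apply/funext => v; rewrite fct_sumE.
by rewrite /pd derive_sum // => i; exact: dF.
Qed.

Definition mx_pderivable p q (A : 'rV[R]_n -> 'M[R]_(p, q)) u :=
  forall i j, pderivable (fun v => A v i j) u.

(** Componentwise derivative along Y, that is, the flat connection of the chart. It is not
    tensorial; Christoffel terms are added where needed. *)
Definition dirmx p q (A : 'rV[R]_n -> 'M[R]_(p, q)) (u Y : 'rV[R]_n) : 'M[R]_(p, q) :=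
  \matrix_(i, j) \sum_l Y 0 l * pd l (fun v => A v i j) u.

Lemma dirmxD p q (A : 'rV[R]_n -> 'M[R]_(p, q)) u Y Z :
  dirmx A u (Y + Z) = dirmx A u Y + dirmx A u Z.
Proof.
apply/matrixP => i j; rewrite !mxE -big_split /=; apply: eq_bigr => l _.
by rewrite mxE mulrDl.
Qed.

Lemma dirmxZ p q (A : 'rV[R]_n -> 'M[R]_(p, q)) u a Y :
  dirmx A u (a *: Y) = a *: dirmx A u Y.
Proof.
apply/matrixP => i j; rewrite !mxE mulr_sumr; apply: eq_bigr => l _.
by rewrite mxE mulrA.
Qed.

Lemma dirmx_tr p q (A : 'rV[R]_n -> 'M[R]_(p, q)) u Y :
  dirmx (fun v => (A v)^T) u Y = (dirmx A u Y)^T.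
Proof.
apply/matrixP => i j; rewrite !mxE; apply: eq_bigr => l _; congr (_ * pd l _ u).
by apply/funext => v; rewrite mxE.
Qed.

Lemma dirmxM p q r (A : 'rV[R]_n -> 'M[R]_(p, q)) (B : 'rV[R]_n -> 'M[R]_(q, r)) u Y :
  mx_pderivable A u -> mx_pderivable B u ->
  dirmx (fun v => A v *m B v) u Y = dirmx A u Y *m B u + A u *m dirmx B u Y.
Proof.
move=> dA dB; apply/matrixP => i j; rewrite !mxE -big_split /=.
under eq_bigr => l _.
  have -> : (fun v => (A v *m B v) i j) = (fun v => \sum_k A v i k * B v k j).
    by apply/funext => v; rewrite mxE.
  rewrite pd_bigsum; last by move=> k; exact: pderivableM.
  rewrite mulr_sumr; under eq_bigr => k _ do rewrite pd_mul //.
  over.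
rewrite exchange_big /=; apply: eq_bigr => k _; rewrite !mxE mulr_suml mulr_sumr.
rewrite -big_split /=; apply: eq_bigr => l _.
by rewrite mulrDr mulrA mulrCA.
Qed.

Lemma mx_pderivableM p q r (A : 'rV[R]_n -> 'M[R]_(p, q)) (B : 'rV[R]_n -> 'M[R]_(q, r)) u :
  mx_pderivable A u -> mx_pderivable B u -> mx_pderivable (fun v => A v *m B v) u.
Proof.
move=> dA dB i j.
have -> : (fun v => (A v *m B v) i j) = (fun v => \sum_k A v i k * B v k j).
  by apply/funext => v; rewrite mxE.
by apply: pderivable_sum => k; exact: pderivableM.
Qed.

Lemma mx_pderivable_tr p q (A : 'rV[R]_n -> 'M[R]_(p, q)) u :
  mx_pderivable A u -> mx_pderivable (fun v => (A v)^T) u.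
Proof.
move=> dA i j; have -> : (fun v => (A v)^T i j) = (fun v => A v j i).
  by apply/funext => v; rewrite mxE.
exact: dA.
Qed.

Lemma dirmx_open (U : set 'rV[R]_n) p q (A B : 'rV[R]_n -> 'M[R]_(p, q)) u Y :
  open U -> U u -> (forall v, U v -> A v = B v) -> dirmx A u Y = dirmx B u Y.
Proof.
move=> oU Uu AB; apply/matrixP => i j; rewrite !mxE; apply: eq_bigr => l _.
by congr (_ * _); apply: (open_eq_pd _ oU) => // v Uv; rewrite AB.
Qed.

End PartiallyDerivable.

(** * The quadratic identity satisfied by commuting flows *)
Section CommutingFlows.
Variables (R : realType) (n : nat).

Lemma is_derive_sum_fun (V W : normedModType R) p (F : 'I_p -> V -> W) (dF : 'I_p -> W) x v :
  (forall i, is_derive x v (F i) (dF i)) ->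
  is_derive x v (fun y => \sum_i F i y) (\sum_i dF i).
Proof.
move=> H; have -> : (fun y => \sum_i F i y) = \sum_i F i.
  by apply/funext => y; rewrite fct_sumE.
exact: is_derive_sum.
Qed.

Lemma is_derive_rV (V : normedModType R) (F : V -> 'rV[R]_n) x v (d : 'rV[R]_n) :
  (forall i, is_derive x v (fun y => F y 0 i) (d 0 i)) -> is_derive x v F d.
Proof.
move=> H; have dF : derivable F x v.
  by apply/derivable_mxP => i j; rewrite ord1; apply: ex_derive.
apply: DeriveDef => //; rewrite derive_mx //; apply/rowP => j; rewrite mxE.
exact: derive_val.
Qed.

Lemma is_derive_rV_coord (V : normedModType R) (F : V -> 'rV[R]_n) x v (d : 'rV[R]_n) i :
  is_derive x v F d -> is_derive x v (fun y => F y 0 i) (d 0 i).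
Proof.
move=> [dF dE]; apply: DeriveDef; first exact: ((derivable_mxP _ _ _).1 dF 0 i).
by rewrite -dE derive_mx // mxE.
Qed.

Lemma is_derive_pairing (p : 'I_n -> 'rV[R]_n -> R) (c w : R -> 'rV[R]_n) t c' w' :
  (forall l, differentiable (p l) (c t)) ->
  is_derive t (1 : R) c c' -> is_derive t (1 : R) w w' ->
  is_derive t (1 : R) (fun s => \sum_l p l (c s) * w s 0 l)
    (\sum_l ((\sum_r c' 0 r * pd r (p l) (c t)) * w t 0 l + p l (c t) * w' 0 l)).
Proof.
move=> dp dc dw; apply: is_derive_sum_fun => l.
have d1 := is_derive_curve (dp l) dc; have d2 := is_derive_rV_coord l dw.
apply: is_derive_eq (is_deriveM d1 d2) _.
by rewrite addrC; congr (_ + _); exact: mulrC.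
Qed.

Lemma derive1_val (V : normedModType R) (f : R -> V) t d :
  is_derive t (1 : R) f d -> derive1 f t = d.
Proof. by move=> ?; rewrite derive1E derive_val. Qed.

Lemma smooth_curve_derive (c : R -> 'rV[R]_n) k t : smooth_curve c ->
  is_derive t (1 : R) (derive1n k c) (derive1n k.+1 c t).
Proof.
by move=> sc; apply: DeriveDef; [exact: sc | rewrite derive1nS derive1E].
Qed.

(** A family of curves with bounded image that is stable under differentiation, so smoothness on the
    whole line follows by induction. *)
Definition harmonic (c0 v : 'rV[R]_n) (w a b x : R) : 'rV[R]_n :=
  c0 + (a * sin (w * x) + b * cos (w * x)) *: v.

Lemma is_derive_harmonic c0 v w a b x :
  is_derive x (1 : R) (harmonic c0 v w a b) (harmonic 0 v w (- (w * b)) (w * a) x).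
Proof.
apply: is_derive_rV => i; rewrite /harmonic.
have -> : (fun y => (c0 + (a * sin (w * y) + b * cos (w * y)) *: v) 0 i) =
    (fun y => c0 0 i + (a * sin (w * y) + b * cos (w * y)) * v 0 i).
  by apply/funext => y; rewrite !mxE.
by apply: is_derive_eq; rewrite !mxE /GRing.scale /=; ring.
Qed.

Lemma harmonic_smooth c0 v w a b : smooth_curve (harmonic c0 v w a b).
Proof.
move=> k; have [c1 [a' [b' ->]]] : exists c1 a' b', derive1n k (harmonic c0 v w a b) = harmonic c1 v w a' b'.
  elim: k => [|k [c1 [a' [b' IH]]]]; first by exists c0, a, b.
  exists 0, (- (w * b')), (w * a'); rewrite derive1nS IH.
  by apply/funext => x; apply: derive1_val; exact: is_derive_harmonic.
by move=> x; have [] := is_derive_harmonic c1 v w a' b' x.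
Qed.

Variables (U : set 'rV[R]_n) (A B : 'rV[R]_n -> 'M[R]_n).
Hypothesis oU : open U.
Hypothesis dA : forall u i j, U u -> differentiable (fun v => A v i j) u.
Hypothesis dB : forall u i j, U u -> differentiable (fun v => B v i j) u.

(** Where u_xx = 0 the term A B u_xx drops out and only the part quadratic in u_x is left: the chain
    rule acts on A at the moving point, and on B inside the x-derivative of the moving velocity. *)
Lemma mixed_time_derivativeE (c : R -> 'rV[R]_n) x : smooth_curve c -> (forall x, U (c x)) ->
  derive1n 2 c x = 0 ->
  let Y := derive1 c x in
  mixed_time_derivative A B c x =
    Y *m (dirmx A (c x) (Y *m (B (c x))^T))^T + Y *m (dirmx B (c x) Y)^T *m (A (c x))^T.
Proof.
move=> sc Uc c2 Y.
have dc y : is_derive y (1 : R) c (derive1 c y) by exact: (smooth_curve_derive 0).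
have dc1 y : is_derive y (1 : R) (derive1 c) (derive1n 2 c y) by exact: (smooth_curve_derive 1).
pose b y := derive1 (hydro B c) y.
have db y : is_derive y (1 : R) (hydro B c) (\row_i \sum_l
   ((\sum_r derive1 c y 0 r * pd r (fun v => B v i l) (c y)) * derive1 c y 0 l
     + B (c y) i l * derive1n 2 c y 0 l)).
  apply: is_derive_rV => i; rewrite mxE.
  have -> : (fun y => hydro B c y 0 i) = (fun y => \sum_l B (c y) i l * derive1 c y 0 l).
    by apply/funext => z; rewrite mxE.
  by apply: (@is_derive_pairing (fun l v => B v i l)) => // l; exact: dB.
have bE : b x = Y *m (dirmx B (c x) Y)^T.
  rewrite /b (derive1_val (db x)); apply/rowP => i; rewrite !mxE; apply: eq_bigr => l _.
  by rewrite c2 !mxE mulr0 addr0 mulrC.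
have hE : hydro B c x = Y *m (B (c x))^T.
  by apply/rowP => i; rewrite !mxE; apply: eq_bigr => l _; rewrite mxE mulrC.
apply: derive1_val; apply: is_derive_rV => i.
have dl s : is_derive x (1 : R) (fun y => c y + s *: hydro B c y) (Y + s *: b x).
  have := is_deriveD (dc x) (is_deriveZ s (db x)).
  by rewrite /b (derive1_val (db x)).
(* At fixed x both the point and its x-derivative depend affinely on s, so the outer derivative is
   that of a pairing along two lines. *)
have -> : (fun s => hydro A (fun y => c y + s *: hydro B c y) x 0 i) =
    (fun s => \sum_l A (c x + s *: hydro B c x) i l * (Y + s *: b x) 0 l).
  by apply/funext => s; rewrite mxE (derive1_val (dl s)).
have := @is_derive_pairing (fun l v => A v i l)
  (fun s => c x + s *: hydro B c x) (fun s => Y + s *: b x) 0 (hydro B c x) (b x).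
rewrite !scale0r !addr0 => H.
apply: is_derive_eq (H _ _ _) _.
- by move=> l; exact: dA.
- exact: is_derive_line.
- exact: is_derive_line.
rewrite big_split -hE -bE !mxE; congr (_ + _); apply: eq_bigr => l _; rewrite !mxE mulrC //.
Qed.


End CommutingFlows.

(** * Polarization of the commutation relation *)

Section FlowForm.
Variables (R : realType) (n : nat) (U : set 'rV[R]_n).
Hypothesis oU : open U.

Definition flow_form (A B : 'rV[R]_n -> 'M[R]_n) (u Y Z : 'rV[R]_n) : 'rV[R]_n :=
  Z *m (dirmx A u (Y *m (B u)^T))^T + Z *m (dirmx B u Y)^T *m (A u)^T.

Lemma flow_formDl A B u Y Z T :
  flow_form A B u (Y + Z) T = flow_form A B u Y T + flow_form A B u Z T.
Proof.
by rewrite /flow_form mulmxDl !dirmxD !linearD /= mulmxDl addrACA.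
Qed.

Lemma flow_formDr A B u Y Z T :
  flow_form A B u T (Y + Z) = flow_form A B u T Y + flow_form A B u T Z.
Proof. by rewrite /flow_form !mulmxDl addrACA. Qed.

Variables (A B : 'rV[R]_n -> 'M[R]_n).
Hypothesis dA : forall u i j, U u -> differentiable (fun v => A v i j) u.
Hypothesis dB : forall u i j, U u -> differentiable (fun v => B v i j) u.
Hypothesis AB : commuting_flows U A B.

(** The test curve x -> u + (sin(w x) / w) Y has position u, velocity Y and zero second derivative
    at x = 0, and remains in a ball inside U for large w. *)
Lemma flow_form_diag u Y : U u -> flow_form A B u Y Y = flow_form B A u Y Y.
Proof.
move=> Uu.
have /nbhs_ballP[d /= d0 dP] : nbhs u U by exact: open_nbhs_nbhs.
(* The amplitude |Y| / w is then strictly less than d; the added 1 keeps w positive when Y = 0. *)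
pose w := (`|Y| + 1) / d.
have w0 : 0 < w by rewrite divr_gt0 // ltr_wpDl.
pose c := harmonic u Y w w^-1 0.
have Uc x : U (c x).
  apply: dP; rewrite -ball_normE /ball_ /= /c /harmonic mul0r addr0 opprD addNKr normrN.
  rewrite normrZ normrM (ger0_norm (ltW _)) ?invr_gt0 //.
  apply: (@le_lt_trans _ _ (w^-1 * 1 * `|Y|)).
    apply: ler_wpM2r => //; apply: ler_wpM2l; first by rewrite ltW // invr_gt0.
    by rewrite ler_norml sin_geN1 sin_le1.
  rewrite mulr1 mulrC ltr_pdivrMr // /w mulrC divfK ?gt_eqF //.
  by rewrite ltrDl.
have c1 : derive1 c = harmonic 0 Y w 0 1.
  apply/funext => x; rewrite (derive1_val (is_derive_harmonic _ _ _ _ _ _)).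
  by rewrite mulr0 oppr0 mulfV ?gt_eqF.
have c2 : derive1n 2 c 0 = 0.
  rewrite derive1nS derive1n1 c1 (derive1_val (is_derive_harmonic _ _ _ _ _ _)).
  by rewrite /harmonic mulr0 sin0 mulr0 mul0r addr0 scale0r addr0.
have sc : smooth_curve c by exact: harmonic_smooth.
have c0E : c 0 = u by rewrite /c /harmonic mulr0 sin0 mulr0 mul0r addr0 scale0r addr0.
have c1E : derive1 c 0 = Y.
  by rewrite c1 /harmonic mul0r mulr0 cos0 !add0r mulr1 scale1r.
have := AB sc Uc 0.
rewrite (mixed_time_derivativeE dA dB) // (mixed_time_derivativeE dB dA) //.
by rewrite c0E c1E.
Qed.

Lemma flow_form_polarized u Y Z : U u ->
  flow_form A B u Y Z + flow_form A B u Z Y = flow_form B A u Y Z + flow_form B A u Z Y.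
Proof.
move=> Uu; have := flow_form_diag (Y + Z) Uu.
have formD (A' B' : 'rV[R]_n -> 'M[R]_n) : flow_form A' B' u (Y + Z) (Y + Z) =
    flow_form A' B' u Y Y + flow_form A' B' u Z Z
    + (flow_form A' B' u Y Z + flow_form A' B' u Z Y).
  by rewrite flow_formDl !flow_formDr [flow_form _ _ _ Z Y + _]addrC addrACA.
by rewrite !formD !flow_form_diag // => /addrI.
Qed.

(** The k-th component of the polarized relation on the coordinate vectors q and l. *)
Lemma flow_identity u k l q : U u ->
  \sum_p (B u p q * pd p (fun v => A v k l) u + B u p l * pd p (fun v => A v k q) u
     + A u k p * pd l (fun v => B v p q) u + A u k p * pd q (fun v => B v p l) u) =
  \sum_p (A u p q * pd p (fun v => B v k l) u + A u p l * pd p (fun v => B v k q) u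
     + B u k p * pd l (fun v => A v p q) u + B u k p * pd q (fun v => A v p l) u).
Proof.
move=> Uu; have := flow_form_polarized (delta_mx 0 q) (delta_mx 0 l) Uu.
have formE (A' B' : 'rV[R]_n -> 'M[R]_n) (q' l' : 'I_n) :
    flow_form A' B' u (delta_mx 0 q') (delta_mx 0 l') 0 k =
    \sum_p (B' u p q' * pd p (fun v => A' v k l') u + A' u k p * pd q' (fun v => B' v p l') u).
  rewrite /flow_form -!rowE mxE big_split /= !mxE; congr (_ + _).
    by apply: eq_bigr => p _; rewrite !mxE.
  apply: eq_bigr => p _; rewrite !mxE mulrC; congr (_ * _).
  rewrite (bigD1 q') //= mxE !eqxx mul1r big1 ?addr0 // => r /negPf rq.
  by rewrite mxE rq andbF mul0r.
move=> /(congr1 (fun M : 'rV[R]_n => M 0 k)); rewrite mxE [in RHS]mxE !formE -!big_split /=.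
move=> H; apply: etrans (etrans H _); apply: eq_bigr => p _; ring.
Qed.

End FlowForm.

(** * The Levi-Civita connection in an orthogonal commuting frame *)
Section LeviCivita.
Variables (R : realType) (n : nat).

Definition dir (f : 'rV[R]_n -> R) (u Y : 'rV[R]_n) : R := \sum_l Y 0 l * pd l f u.

Lemma dirmxE p q (A : 'rV[R]_n -> 'M[R]_(p, q)) u Y i j :
  dirmx A u Y i j = dir (fun v => A v i j) u Y.
Proof. by rewrite mxE. Qed.

Lemma dirM f g u Y : pderivable f u -> pderivable g u ->
  dir (fun v => f v * g v) u Y = dir f u Y * g u + f u * dir g u Y.
Proof.
move=> df dg; rewrite /dir mulr_suml mulr_sumr -big_split; apply: eq_bigr => l _ /=.
by rewrite pd_mul //; ring.
Qed.

Lemma dir_sum p (F : 'I_p -> 'rV[R]_n -> R) u Y : (forall i, pderivable (F i) u) ->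
  dir (fun v => \sum_i F i v) u Y = \sum_i dir (F i) u Y.
Proof.
move=> dF; rewrite /dir exchange_big; apply: eq_bigr => l _ /=.
by rewrite pd_bigsum // mulr_sumr.
Qed.

Lemma dir_cst (a : R) u Y : dir (fun=> a) u Y = 0.
Proof. by rewrite /dir big1 // => l _; rewrite pd_cst mulr0. Qed.

Lemma dir_open (U : set 'rV[R]_n) f g u Y :
  open U -> U u -> (forall v, U v -> f v = g v) -> dir f u Y = dir g u Y.
Proof. by move=> oU Uu fg; apply: eq_bigr => l _; rewrite (open_eq_pd _ oU Uu fg). Qed.

Lemma dirmxZf (f : 'rV[R]_n -> R) p q (A : 'rV[R]_n -> 'M[R]_(p, q)) u Y :
  pderivable f u -> mx_pderivable A u ->
  dirmx (fun v => f v *: A v) u Y = dir f u Y *: A u + f u *: dirmx A u Y.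
Proof.
move=> df dA; apply/matrixP => i j; rewrite dirmxE.
transitivity (dir f u Y * A u i j + f u * dir (fun v => A v i j) u Y); last by rewrite !mxE.
rewrite -dirM //; apply: eq_bigr => l _; congr (_ * pd l _ u).
by apply/funext => v; rewrite mxE.
Qed.

Variable g : 'rV[R]_n -> 'M[R]_n.
Hypothesis gT : forall v, (g v)^T = g v.
Local Notation gi v := (invmx (g v)).

Lemma invmx_sym v : (gi v)^T = gi v.
Proof. by rewrite trmx_inv gT. Qed.

Lemma christoffel_sym i j k u : christoffel g i j k u = christoffel g i k j u.
Proof.
have sw a b : (fun v => gi v a b) = (fun v => gi v b a).
  by apply/funext => v; rewrite -{1}[gi v]invmx_sym mxE.
rewrite /christoffel; congr (_ * _); apply: eq_bigr => l _; congr (_ * _).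
by rewrite (sw k j); congr (_ - _); exact: addrC.
Qed.

Definition christoffel_form (u Y Z : 'rV[R]_n) : 'rV[R]_n :=
  \row_i \sum_j \sum_k christoffel g i j k u * Y 0 j * Z 0 k.

Lemma christoffel_form_sym u Y Z : christoffel_form u Y Z = christoffel_form u Z Y.
Proof.
apply/rowP => i; rewrite !mxE exchange_big /=; apply: eq_bigr => j _; apply: eq_bigr => k _.
by rewrite christoffel_sym mulrAC.
Qed.

Lemma christoffel_lower r j k u : g u \in unitmx ->
  \sum_i gi u r i * christoffel g i j k u =
  2^-1 * (pd j (fun v => gi v r k) u + pd k (fun v => gi v r j) u
          - pd r (fun v => gi v j k) u).
Proof.
move=> gU; pose T : 'cV[R]_n := \col_l (pd j (fun v => gi v l k) u
  + pd k (fun v => gi v l j) u - pd l (fun v => gi v j k) u).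
have -> : \sum_i gi u r i * christoffel g i j k u = (gi u *m (2^-1 *: (g u *m T))) r 0.
  rewrite mxE; apply: eq_bigr => i _; rewrite !mxE; congr (_ * (_ * _)).
  by apply: eq_bigr => l _; rewrite mxE.
by rewrite -scalemxAr mulKmx // !mxE.
Qed.

Local Notation dgi := (dirmx (fun v => gi v)).

(** Koszul's formula for vectors with constant components in the chart: only derivatives of the
    covariant metric occur. *)
Lemma christoffel_form_lower u V Y Z : g u \in unitmx ->
  (V *m gi u *m (christoffel_form u Y Z)^T) 0 0 =
  2^-1 * ((V *m dgi u Y *m Z^T) 0 0 + (V *m dgi u Z *m Y^T) 0 0
          - (Y *m dgi u V *m Z^T) 0 0).
Proof.
move=> gU.
pose tri (F : 'I_n -> 'I_n -> 'I_n -> R) :=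
  \sum_r \sum_j \sum_k (V 0 r * Y 0 j * Z 0 k) * F r j k.
have e1 : (V *m dgi u Y *m Z^T) 0 0 = tri (fun r j k => pd j (fun v => gi v r k) u).
  rewrite mxE; under eq_bigr => k _.
    rewrite !mxE mulr_suml; under eq_bigr => r _.
      rewrite mxE mulr_sumr mulr_suml; under eq_bigr => j _ do rewrite mulrA mulrAC.
      over.
    over.
  rewrite exchange_big /=; apply: eq_bigr => r _; exact: exchange_big.
have e2 : (V *m dgi u Z *m Y^T) 0 0 = tri (fun r j k => pd k (fun v => gi v r j) u).
  rewrite mxE; under eq_bigr => j _.
    rewrite !mxE mulr_suml; under eq_bigr => r _.
      rewrite mxE mulr_sumr mulr_suml; under eq_bigr => k _ do rewrite mulrA mulrAC [_ * Y 0 j]mulrAC.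
      over.
    over.
  exact: exchange_big.
have e3 : (Y *m dgi u V *m Z^T) 0 0 = tri (fun r j k => pd r (fun v => gi v j k) u).
  rewrite mxE; under eq_bigr => k _.
    rewrite !mxE mulr_suml; under eq_bigr => j _.
      rewrite mxE mulr_sumr mulr_suml; under eq_bigr => r _ do rewrite mulrA mulrAC [Y 0 j * _]mulrC.
      over.
    rewrite exchange_big /=; over.
  rewrite exchange_big /=; apply: eq_bigr => r _; exact: exchange_big.
have -> : (V *m gi u *m (christoffel_form u Y Z)^T) 0 0 =
    tri (fun r j k => \sum_i gi u r i * christoffel g i j k u).
  rewrite -mulmxA mxE /tri; apply: eq_bigr => r _; rewrite mxE.
  under eq_bigr => i _.
    rewrite !mxE mulr_sumr; under eq_bigr => j _ do rewrite mulr_sumr.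
    over.
  rewrite exchange_big mulr_sumr /=; apply: eq_bigr => j _.
  rewrite exchange_big mulr_sumr /=; apply: eq_bigr => k _.
  rewrite !mulr_sumr; apply: eq_bigr => i _; ring.
rewrite e1 e2 e3 /tri -big_split /= -sumrB mulr_sumr; apply: eq_bigr => r _.
rewrite -big_split /= -sumrB mulr_sumr; apply: eq_bigr => j _.
rewrite -big_split /= -sumrB mulr_sumr; apply: eq_bigr => k _.
rewrite christoffel_lower //; ring.
Qed.

(** The index-free reading of [nabla], as (nabla_Y W) Z; with Y and Z taken from the frame, the
    eigenvector relations become applicable. *)
Lemma nabla_form (W : 'rV[R]_n -> 'M[R]_n) (u Y Z : 'rV[R]_n) i :
  \sum_k \sum_j Y 0 k * Z 0 j * nabla g W k i j u =
  (Z *m (dirmx W u Y)^T + christoffel_form u Y (Z *m (W u)^T)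
   - christoffel_form u Y Z *m (W u)^T) 0 i.
Proof.
rewrite [RHS]mxE [X in _ = X + _]mxE [X in _ = _ + X]mxE.
under eq_bigr => k _.
  under eq_bigr => j _ do rewrite /nabla mulrBr mulrDr.
  rewrite sumrB big_split /=; over.
rewrite sumrB big_split /=; congr (_ + _ - _).
- rewrite mxE exchange_big; apply: eq_bigr => j _; rewrite !mxE mulr_sumr.
  by apply: eq_bigr => k _; ring.
- rewrite mxE; apply: eq_bigr => k _.
  under eq_bigr => j _ do rewrite mulr_sumr.
  rewrite exchange_big; apply: eq_bigr => s _; rewrite mxE mulr_sumr.
  by apply: eq_bigr => j _; rewrite mxE; ring.
- rewrite mxE; under [RHS]eq_bigr => s _.
    rewrite !mxE mulr_suml; under eq_bigr => k _ do rewrite mulr_suml.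
    over.
  rewrite [RHS]exchange_big; apply: eq_bigr => k _ /=.
  rewrite [RHS]exchange_big; apply: eq_bigr => j _ /=.
  by rewrite mulr_sumr; apply: eq_bigr => s _; ring.
Qed.

Section Frame.
Variables (U : set 'rV[R]_n) (Z : 'I_n -> 'rV[R]_n -> 'rV[R]_n).
Hypothesis oU : open U.
Hypothesis gU : forall u, U u -> g u \in unitmx.
Hypothesis dg : forall u, U u -> mx_pderivable g u.
Hypothesis dZ : forall a u, U u -> mx_pderivable (Z a) u.
Hypothesis ZU : forall u, U u -> \matrix_a Z a u \in unitmx.
Hypothesis ZZ : forall a b u, U u -> dirmx (Z b) u (Z a u) = dirmx (Z a) u (Z b u).

Definition gram a b u : R := (Z a u *m gi u *m (Z b u)^T) 0 0.
Local Notation N u a b := (dirmx (Z b) u (Z a u)).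
Local Notation D u a f := (dir f u (Z a u)).

Lemma metric_pderivable u : U u -> mx_pderivable (fun v => gi v) u.
Proof. move=> Uu i j; apply: (@pderivable_invmx _ _ U _ g u i j oU Uu).
  by move=> v; exact: gU.
exact: dg. Qed.

Lemma pairing_sym u (Y T : 'rV[R]_n) :
  (Y *m gi u *m T^T) 0 0 = (T *m gi u *m Y^T) 0 0.
Proof.
have -> : Y *m gi u *m T^T = (T *m gi u *m Y^T)^T.
  by rewrite !trmx_mul trmxK invmx_sym mulmxA.
by rewrite [LHS]mxE.
Qed.

Lemma gram_pderivable a b u : U u -> pderivable (gram a b) u.
Proof.
move=> Uu; apply: (@mx_pderivableM _ _ _ _ _ (fun v => Z a v *m gi v) (fun v => (Z b v)^T)).
  by apply: mx_pderivableM; [exact: dZ | exact: metric_pderivable].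
by apply: mx_pderivable_tr; exact: dZ.
Qed.

Lemma dir_gram a b c u : U u ->
  D u a (gram b c) = (Z b u *m dgi u (Z a u) *m (Z c u)^T) 0 0
    + (N u a b *m gi u *m (Z c u)^T) 0 0 + (N u a c *m gi u *m (Z b u)^T) 0 0.
Proof.
move=> Uu; rewrite -dirmxE.
have d1 := @dZ b u Uu; have d2 := metric_pderivable Uu; have d3 := @dZ c u Uu.
rewrite (@dirmxM _ _ _ _ _ (fun v => Z b v *m gi v) (fun v => (Z c v)^T)); first last.
- exact: mx_pderivable_tr.
- exact: mx_pderivableM.
rewrite dirmxM // dirmx_tr mulmxDl.
have add00 (A B : 'M[R]_1) : (A + B) 0 0 = A 0 0 + B 0 0 by rewrite mxE.
rewrite !add00; congr (_ + _); last exact: pairing_sym.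
exact: addrC.
Qed.

(** The vector being lowered is the covariant derivative of [Z c] along [Z a]. Since the frame
    fields commute, the derivatives of the frame cancel and only derivatives of Gram coefficients
    remain. *)
Lemma koszul a b c u : U u ->
  (Z b u *m gi u *m (N u a c + christoffel_form u (Z a u) (Z c u))^T) 0 0 =
  2^-1 * (D u a (gram b c) + D u c (gram b a) - D u b (gram a c)).
Proof.
move=> Uu; rewrite linearD mulmxDr mxE christoffel_form_lower ?gU // !dir_gram //.
rewrite (@ZZ c b u Uu) (@ZZ b a u Uu) (@ZZ c a u Uu) [(Z b u *m gi u *m (dirmx _ _ _)^T) 0 0]pairing_sym.
by field.
Qed.

Variables (m : nat) (W : 'I_m -> 'rV[R]_n -> 'M[R]_n) (eps : 'I_m -> R).
Variable s : 'I_m -> 'I_n -> 'rV[R]_n -> R.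
Hypothesis dW : forall e u, U u -> mx_pderivable (W e) u.
Hypothesis ds : forall e a u, U u -> pderivable (s e a) u.
Hypothesis Ws : forall e a u, U u -> Z a u *m (W e u)^T = s e a u *: Z a u.
Hypothesis Worth : forall e u, U u -> (W e u)^T *m gi u = gi u *m W e u.
Hypothesis orth : forall a b u, U u -> a != b -> gram a b u = 0.
Hypothesis sK : forall a b u, U u ->
  \sum_e eps e * (s e a u * s e b u) * gram b b u = (a == b)%:R.
Hypothesis WW : forall e f u a b, U u ->
  flow_form (W e) (W f) u (Z a u) (Z b u) + flow_form (W e) (W f) u (Z b u) (Z a u) =
  flow_form (W f) (W e) u (Z a u) (Z b u) + flow_form (W f) (W e) u (Z b u) (Z a u).

(** Leibniz on the eigenvector relation [Ws], differentiated along [Z a]. *)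
Lemma dirmx_eigen e a b u : U u ->
  Z b u *m (dirmx (W e) u (Z a u))^T =
  D u a (s e b) *: Z b u + s e b u *: N u a b - N u a b *m (W e u)^T.
Proof.
move=> Uu.
have := @dirmx_open _ _ U _ _ (fun v => Z b v *m (W e v)^T) (fun v => s e b v *: Z b v)
  u (Z a u) oU Uu (fun v Uv => @Ws e b v Uv).
have d1 := @dZ b u Uu; have d2 := @dW e u Uu; have d3 := @ds e b u Uu.
rewrite dirmxM //; last exact: mx_pderivable_tr.
by rewrite dirmxZf // dirmx_tr => <-; rewrite addrC addKr.
Qed.

Lemma gram_neq0 a u : U u -> gram a a u != 0.
Proof.
move=> Uu; apply/eqP => K0; have := @sK a a u Uu.
by rewrite K0 -mulr_suml mulr0 eqxx => /eqP; rewrite eq_sym oner_eq0.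
Qed.

(* In canonical coordinates: (v_f^a - v_f^b) d_a v_e^b = (v_e^a - v_e^b) d_a v_f^b. *)
Lemma commuting_eigenvalues e f a b u : U u -> a != b ->
  (s f a u - s f b u) * D u a (s e b) = (s e a u - s e b u) * D u a (s f b).
Proof.
move=> Uu ab.
(* Pairing with [Z b] kills [Z a], and turns each affinor into its eigenvalue at b because the
   affinors are self-adjoint. *)
pose low (Y : 'rV[R]_n) := (Y *m gi u *m (Z b u)^T) 0 0.
have lowD Y T : low (Y + T) = low Y + low T by rewrite /low !mulmxDl mxE.
have lowZ k Y : low (k *: Y) = k * low Y by rewrite /low -!scalemxAl mxE.
have lowN Y : low (- Y) = - low Y by rewrite -scaleN1r lowZ mulN1r.
have lowW k Y : low (Y *m (W k u)^T) = s k b u * low Y.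
  rewrite /low -(mulmxA Y) Worth // -!mulmxA.
  have -> : W k u *m (Z b u)^T = s k b u *: (Z b u)^T.
    by rewrite -[W k u]trmxK -trmx_mul Ws // linearZ.
  by rewrite -!scalemxAr mxE.
have lowa : low (Z a u) = 0 by exact: orth.
(* The coefficient of [low (N u b a)] is symmetric in k and l, so the unknown derivative of the
   frame disappears when k and l are exchanged and subtracted. *)
have flow k l : low (flow_form (W k) (W l) u (Z a u) (Z b u)
      + flow_form (W k) (W l) u (Z b u) (Z a u)) =
    (s l a u * D u a (s k b) + s k b u * D u a (s l b)) * gram b b u
    + (s l b u * (s k a u - s k b u) + s k b u * (s l a u - s l b u)) * low (N u b a).
  rewrite lowD /flow_form !Ws // !dirmxZ !(lowD, lowW) ![(_ *: _)^T]linearZ /= -!scalemxAr.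
  rewrite !lowZ !dirmx_eigen // !(lowD, lowN, lowZ, lowW) lowa -(@ZZ b a u Uu).
  rewrite -[low (Z b u)]/(gram b b u); ring.
have := congr1 low (@WW e f u a b Uu); rewrite !flow => H.
apply: (mulIf (gram_neq0 b Uu)).
move: H; set K := gram _ _ _; set nu := low _.
set x1 := s _ _ _; set x2 := s _ _ _; set x3 := s _ _ _; set x4 := s _ _ _.
set y1 := D _ _ _; set y2 := D _ _ _ => H.
apply/eqP; rewrite -subr_eq0; apply/eqP; move/eqP: H; rewrite -subr_eq0 => /eqP H.
rewrite -[RHS]H; ring.
Qed.

(** In canonical coordinates: d_a v^b = (v^a - v^b) d_a log sqrt |g_bb|, whose last factor is the
    Christoffel coefficient Gamma^b_{ba}. *)
Lemma eigenvalue_derivative e a b u : U u -> a != b ->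
  gram b b u * D u a (s e b) + 2^-1 * (s e b u - s e a u) * D u a (gram b b) = 0.
Proof.
move=> Uu ab; set K := gram b b u; set dK := D u a (gram b b).
(* [h] is the contravariant coefficient g^{bb} in the frame, inverse to [K], and [t] is half of its
   derivative along [Z a]; differentiating h K = 1 relates [t] to [dK]. *)
pose h := \sum_f eps f * (s f b u * s f b u).
pose t := \sum_f eps f * (s f b u * D u a (s f b)).
have K0 : K != 0 by exact: gram_neq0.
have hK : h * K = 1 by rewrite /h mulr_suml sK ?eqxx.
have dhK : 2 * t * K + h * dK = 0.
  have := @dir_open U (fun v => (\sum_f eps f * (s f b v * s f b v)) * gram b b v)
    (fun=> 1) u (Z a u) oU Uu.
  have d1 f : pderivable (fun v => eps f * (s f b v * s f b v)) u.
    apply: pderivableM; first exact: pderivable_cst.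
    by apply: pderivableM; exact: ds.
  rewrite dir_cst dirM; [|exact: pderivable_sum|exact: gram_pderivable].
  rewrite dir_sum // => <-; last by move=> v Uv; rewrite mulr_suml sK ?eqxx.
  congr (_ * _ + _ * _); rewrite /t mulr_sumr; apply: eq_bigr => f _.
  rewrite dirM; [|exact: pderivable_cst|by apply: pderivableM; exact: ds].
  by rewrite dir_cst dirM; [ring|exact: ds..].
(* The off-diagonal coefficient g^{ab}. Adding it to -h produces the differences v_f^a - v_f^b that
   [commuting_eigenvalues] requires. *)
have hab : \sum_f eps f * (s f a u * s f b u) = 0.
  by apply: (mulIf K0); rewrite mulr_suml sK // (negPf ab) mul0r.
have main : - h * D u a (s e b) = (s e a u - s e b u) * t.
  rewrite /t mulr_sumr.
  transitivity (\sum_f eps f * s f b u * ((s f a u - s f b u) * D u a (s e b))).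
    rewrite -[- h]add0r -[X in X - h]hab /h -sumrB mulr_suml; apply: eq_bigr => f _; ring.
  by apply: eq_bigr => f _; rewrite (commuting_eigenvalues e f Uu ab); ring.
move: main dhK hK; clear -K0; set x := s e a u; set y := s e b u; set d := D _ _ _.
move=> main dhK hK.
have h0 : h != 0 by apply: contra_eq_neq hK => ->; rewrite mul0r eq_sym oner_eq0.
apply: (mulfI h0); rewrite mulr0.
have -> : h * (K * d + 2^-1 * (y - x) * dK) = - K * (- h * d) + 2^-1 * (y - x) * (h * dK) by ring.
have -> : h * dK = - (2 * t * K) by apply/eqP; rewrite -addr_eq0 addrC dhK.
by rewrite main; field.
Qed.

(** The antisymmetrized covariant derivative is a tensor, so it suffices to evaluate it on pairs of
    frame vectors and to pair the result with each [Z b]. *)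
Lemma nabla_affinor_sym e u i j k : U u ->
  nabla g (W e) k i j u = nabla g (W e) j i k u.
Proof.
move=> Uu.
pose F a c : 'rV[R]_n := \row_i' \sum_k' \sum_j' Z a u 0 k' * Z c u 0 j' *
   (nabla g (W e) k' i' j' u - nabla g (W e) j' i' k' u).
(* The terms W applied to a covariant derivative of the frame cancel, since nabla_{Z_a} Z_c is
   symmetric in a and c: the connection is torsion-free and the frame commutes. *)
have FE a c : F a c = D u a (s e c) *: Z c u - D u c (s e a) *: Z a u
    + (s e c u - s e a u) *: (N u a c + christoffel_form u (Z a u) (Z c u)).
  have fZ k' Y T : christoffel_form u Y (k' *: T) = k' *: christoffel_form u Y T.
    apply/rowP => i'; rewrite !mxE mulr_sumr; apply: eq_bigr => j' _.
    by rewrite mulr_sumr; apply: eq_bigr => l' _; rewrite mxE; ring.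
  apply/rowP => i'; rewrite mxE.
  under eq_bigr => k' _ do (under eq_bigr => j' _ do rewrite mulrBr; rewrite sumrB).
  rewrite sumrB nabla_form.
  rewrite exchange_big /=.
  under [X in _ - X]eq_bigr => k' _ do under eq_bigr => j' _ do rewrite [Z a u 0 _ * _]mulrC.
  rewrite nabla_form !Ws // !fZ !dirmx_eigen // (@ZZ c a u Uu).
  rewrite [christoffel_form u (Z c u) _]christoffel_form_sym.
  set Gm := christoffel_form _ _ _; set Nm := N u a c.
  by rewrite !(mxE, mulmxDl); ring.
have low0 a b c : (Z b u *m gi u *m (F a c)^T) 0 0 = 0.
  pose lw (Y : 'rV[R]_n) := (Z b u *m gi u *m Y^T) 0 0.
  have lwD Y T : lw (Y + T) = lw Y + lw T by rewrite /lw linearD mulmxDr mxE.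
  have lwZ x Y : lw (x *: Y) = x * lw Y by rewrite /lw linearZ -scalemxAr mxE.
  have lwN Y : lw (- Y) = - lw Y by rewrite -scaleN1r lwZ mulN1r.
  have lowE : (Z b u *m gi u *m (F a c)^T) 0 0 =
    D u a (s e c) * gram b c u - D u c (s e a) * gram b a u
    + (s e c u - s e a u) * (2^-1 * (D u a (gram b c) + D u c (gram b a) - D u b (gram a c))).
    by rewrite -koszul // -![(_ *m _^T) 0 0]/(lw _) FE !(lwD, lwN, lwZ).
  (* For a and c distinct, b = c and b = a each reduce to [eigenvalue_derivative]; for any other b
     all the Gram coefficients involved vanish on U together with their derivatives. *)
  rewrite lowE; have [->|ac] := eqVneq a c; first by rewrite !subrr mul0r addr0.
  have D0 x y z : y != z -> D u x (gram y z) = 0.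
    move=> yz; rewrite (@dir_open U _ (fun=> 0) u _ oU Uu) ?dir_cst //.
    by move=> v Uv; exact: orth.
  have [->|bc] := eqVneq b c.
    have ca : c != a by rewrite eq_sym.
    rewrite (@orth c a u Uu ca) (D0 c c a ca) (D0 c a c ac).
    rewrite -[RHS](eigenvalue_derivative e Uu ac); ring.
  rewrite (@orth b c u Uu bc) (D0 a b c bc) (D0 b a c ac).
  have [->|ba] := eqVneq b a.
    have := eigenvalue_derivative e Uu (_ : c != a); rewrite eq_sym => /(_ ac) H.
    apply: oppr_inj; rewrite oppr0 -[RHS]H; ring.
  by rewrite (@orth b a u Uu ba) (D0 c b a ba); ring.
have F0 a c : F a c = 0.
  have : (\matrix_b Z b u) *m gi u *m (F a c)^T = 0.
    apply/colP => b; rewrite [RHS]mxE -[RHS](low0 a b c) -mulmxA -[in RHS]mulmxA.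
    by rewrite !mxE; apply: eq_bigr => l _; rewrite mxE.
  move=> /(congr1 (fun M => invmx (gi u) *m (invmx (\matrix_b Z b u) *m M))).
  rewrite -mulmxA mulKmx ?ZU // mulKmx ?unitmx_inv ?gU // !mulmx0 => /(congr1 trmx).
  by rewrite trmxK trmx0.
pose M : 'M[R]_n := \matrix_(k', j') (nabla g (W e) k' i j' u - nabla g (W e) j' i k' u).
have M0 : M = 0.
  have : (\matrix_b Z b u) *m M *m (\matrix_b Z b u)^T = 0.
    apply/matrixP => a c; have F00 : F a c 0 i = 0 by rewrite F0 mxE.
    rewrite [RHS]mxE -[RHS]F00 /F [RHS]mxE [LHS]mxE [RHS]exchange_big /=.
    apply: eq_bigr => j' _; rewrite ![(_ *m _) _ _]mxE !mulr_suml.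
    by apply: eq_bigr => k' _; rewrite !mxE; ring.
  move=> /(congr1 (fun X => invmx (\matrix_b Z b u) *m X *m invmx (\matrix_b Z b u)^T)).
  by rewrite -[_ *m M *m _]mulmxA mulKmx ?ZU // mulmxK ?unitmx_tr ?ZU // mulmx0 mul0mx.
have := congr1 (fun M : 'M[R]_n => M k j) M0; rewrite !mxE => /eqP.
by rewrite subr_eq0 => /eqP.
Qed.

End Frame.
End LeviCivita.

(** * The skew-symmetric form with kernel sgn(x-y)/2 *)
Section FubiniSection.
Context (d : measure_display) (T : measurableType d) (R : realType).
Variable m : {sigma_finite_measure set T -> \bar R}.
Implicit Types F G H : T -> R.

Lemma integral_normE H : m.-integrable setT (EFin \o H) ->
  (\int[m]_y `|(H y)%:E| = (\int[m]_y `|H y|)%:E)%E.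
Proof.
move=> iH; rewrite /Rintegral fineK //.
exact: (integrable_fin_num measurableT (integrable_norm iH)).
Qed.

Lemma integral_indic_mulE (k : R) H (A : set T) : measurable A ->
  m.-integrable setT (EFin \o H) ->
  (\int[m]_y (k * H y * \1_A y)%:E = (k * \int[m]_(y in A) H y)%:E)%E.
Proof.
move=> mA iH; have {}iH : m.-integrable A (EFin \o H) by apply: integrableS iH.
rewrite -RintegralZl // /Rintegral fineK; last first.
  apply: (integrable_fin_num mA); exact: (integrableZl mA k iH).
rewrite [RHS]integral_mkcond; apply: eq_integral => y _.
by rewrite /patch indicE; case: (y \in A) => /=; rewrite ?mulr1 ?mulr0.
Qed.

(** Fubini for F(x) G(y) restricted to S, integrable on the product because it is dominated by
    |F(x)| |G(y)|. *)
Lemma Rintegral_swap_section F G (S : set (T * T)) : measurable S ->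
  m.-integrable setT (EFin \o F) -> m.-integrable setT (EFin \o G) ->
  \int[m]_x (F x * \int[m]_(y in xsection S x) G y) =
  \int[m]_y (G y * \int[m]_(x in ysection S y) F x).
Proof.
move=> mS iF iG.
pose f (z : T * T) : \bar R := (F z.1 * G z.2 * \1_S z)%:E.
have mF : measurable_fun setT F by apply/measurable_EFinP; exact: measurable_int iF.
have mG : measurable_fun setT G by apply/measurable_EFinP; exact: measurable_int iG.
have mf : measurable_fun setT f.
  apply/measurable_EFinP; apply: measurable_funM; last exact: measurable_indic.
  apply: measurable_funM.
    by apply: (measurableT_comp mF); exact: measurable_fst.
  by apply: (measurableT_comp mG); exact: measurable_snd.
have mFn : measurable_fun setT (fun x => `|F x|) by exact: measurableT_comp.
have mGn : measurable_fun setT (fun x => `|G x|) by exact: measurableT_comp.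
have bnd : (\int[m]_x \int[m]_y `|f (x, y)| < +oo)%E.
  apply: (@le_lt_trans _ _ (\int[m]_x (`|F x| * \int[m]_y `|G y|)%:E)%E).
    apply: ge0_le_integral => //=.
    - by move=> x _; exact: integral_ge0.
    - apply: (measurable_fun_fubini_tonelli_F (abse \o f)) => //=; exact: measurableT_comp.
    - by apply/measurable_EFinP; apply: measurable_funM.
    - move=> x _; apply: (@le_trans _ _ (\int[m]_y (`|F x|%:E * `|(G y)%:E|))%E).
        apply: ge0_le_integral => //=.
        + have mfx : measurable_fun setT (fun y => f (x, y)).
            by apply: (measurableT_comp mf); exact: measurable_pair1.
          have mafx : measurable_fun setT (abse \o (fun y => f (x, y))) by exact: measurableT_comp.
          exact: mafx.
        + by apply/measurable_EFinP; apply: measurable_funM.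
        + move=> y _; rewrite lee_fin !normrM -[leRHS]mulr1 ler_wpM2l //.
          by rewrite indicE; case: (_ \in _); rewrite ?normr1 ?normr0.
      rewrite ge0_integralZl //=; first by rewrite integral_normE // EFinM.
      by apply/measurable_EFinP.
  have -> : (\int[m]_x (`|F x| * \int[m]_y `|G y|)%:E =
      ((\int[m]_x `|F x|) * \int[m]_y `|G y|)%:E)%E.
    have := integral_indic_mulE (\int[m]_y `|G y|) measurableT (integrable_norm iF).
    rewrite mulrC => <-; apply: eq_integral => x _.
    by rewrite indicT mulr1 mulrC.
  exact: ltry.
have := Fubini ((@integrable12ltyP _ _ _ _ R m m f mf).2 bnd).
have e1 x : (\int[m]_y f (x, y) = (F x * \int[m]_(y in xsection S x) G y)%:E)%E.
  rewrite -integral_indic_mulE //; last exact: measurable_xsection.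
  apply: eq_integral => y _; rewrite /f /=; congr (_ * _)%:E.
  by rewrite !indicE mem_xsection.
have e2 y : (\int[m]_x f (x, y) = (G y * \int[m]_(x in ysection S y) F x)%:E)%E.
  rewrite -integral_indic_mulE //; last exact: measurable_ysection.
  apply: eq_integral => x _; rewrite /f /= [F x * _]mulrC; congr (_ * _)%:E.
  by rewrite !indicE mem_ysection.
under eq_integral do rewrite e1.
under [in RHS]eq_integral do rewrite e2.
by rewrite /Rintegral => ->.
Qed.

End FubiniSection.

(** * Antiderivative and nonlocal form on continuous integrable functions *)

Section NonlocalForm.
Variable R : realType.
Local Notation mu := (@lebesgue_measure R).
Implicit Types (F G h : R -> R).

(** Integrability bounds the antiderivative; continuity makes it differentiable at every point, not
    just almost everywhere. *)
Definition cint F := continuous F /\ mu.-integrable setT (EFin \o F).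

Lemma cint_integrable F : cint F -> mu.-integrable setT (EFin \o F).
Proof. by case. Qed.

Lemma continuous_measurable F : continuous F -> measurable_fun setT F.
Proof. exact: continuous_measurable_fun. Qed.

Lemma cintD F G : cint F -> cint G -> cint (fun x => F x + G x).
Proof.
move=> [cF iF] [cG iG]; split; first by move=> x; apply: continuousD; [exact: cF|exact: cG].
exact: (integrableD measurableT iF iG).
Qed.

Lemma cintZ k F : cint F -> cint (fun x => k * F x).
Proof.
move=> [cF iF]; split; first by move=> x; apply: continuousM; [exact: cst_continuous|exact: cF].
exact: (integrableZl measurableT k iF).
Qed.

Lemma cint0 : cint (fun=> 0).
Proof. by split; [move=> x; exact: cst_continuous|exact: integrable0]. Qed.

Lemma cint_sum p (F : 'I_p -> R -> R) : (forall i, cint (F i)) ->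
  cint (fun x => \sum_i F i x).
Proof.
move=> cF; elim: p F cF => [|p IH] F cF.
  have -> : (fun x => \sum_(i < 0) F i x) = fun=> 0.
    by apply/funext => x; rewrite big_ord0.
  exact: cint0.
have -> : (fun x => \sum_(i < p.+1) F i x) =
    (fun x => F ord0 x + \sum_(i < p) F (lift ord0 i) x).
  by apply/funext => x; rewrite big_ord_recl.
by apply: cintD => //; apply: IH.
Qed.

Lemma cint_dom F G : continuous F -> cint G -> (forall x, `|F x| <= `|G x|) -> cint F.
Proof.
move=> cF [cG iG] FG; split=> //.
apply: (le_integrable measurableT _ _ iG) => /=.
  by apply/measurable_EFinP; exact: continuous_measurable.
by move=> x _; rewrite lee_fin.
Qed.

Lemma cint_norm F : cint F -> cint (fun x => `|F x|).
Proof.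
move=> [cF iF]; split; first by move=> x; apply: continuous_comp; [exact: cF|exact: norm_continuous].
exact: integrable_norm.
Qed.

Lemma cint_mulb F h (M : R) : cint F -> continuous h -> (forall x, `|h x| <= M) ->
  cint (fun x => F x * h x).
Proof.
move=> cF ch hM; have M0 : 0 <= M by apply: le_trans (normr_ge0 _) (hM 0).
apply: (@cint_dom _ (fun x => M * `|F x|)).
- by move=> x; apply: continuousM; [exact: cF.1|exact: ch].
- exact/cintZ/cint_norm.
- by move=> x; rewrite !normrM normr_id mulrC (ger0_norm M0) ler_wpM2r.
Qed.

Lemma integrable_sub F (A : set R) : measurable A -> cint F -> mu.-integrable A (EFin \o F).
Proof. by move=> mA [_]; apply: integrableS. Qed.

Lemma Rintegral_split F x : cint F ->
  \int[mu]_(y in `[x, +oo[) F y = \int[mu]_y F y - \int[mu]_(y in `]-oo, x]) F y.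
Proof.
move=> cF; have iF : mu.-integrable [set` Interval -oo%O +oo%O] (EFin \o F).
  by rewrite set_itvNyy; exact: cint_integrable.
have := Rintegral_itvB iF (x := x); rewrite set_itvNyy => -> //.
by rewrite Rintegral_itv_obnd_cbnd //; exact: integrable_sub.
Qed.

Lemma dx_invE F x : cint F ->
  dx_inv F x = \int[mu]_(y in `]-oo, x]) F y - 2^-1 * \int[mu]_y F y.
Proof. by move=> cF; rewrite /dx_inv Rintegral_split //; field. Qed.

Lemma is_derive_dx_inv F x : cint F -> is_derive x (1 : R) (dx_inv F) (F x).
Proof.
move=> cF; have -> : dx_inv F = (fun x => \int[mu]_(y in `]-oo, x]) F y - 2^-1 * \int[mu]_y F y).
  by apply/funext => y; rewrite dx_invE.
have iF : mu.-integrable `]-oo, (x + 1)] (EFin \o F) by exact: integrable_sub.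
have x1 : x < x + 1 by rewrite ltrDl.
have [||dF dE] := @continuous_FTC1 R F -oo%O x (x + 1) x1 iF.
- by rewrite /= ltNyr.
- exact: cF.1.
have dF' : is_derive x (1 : R) (fun x => \int[mu]_(y in `]-oo, x]) F y) (F x).
  apply: DeriveDef; first exact: dF.
  by rewrite -derive1E; exact: dE.
by apply: is_derive_eq; rewrite subr0.
Qed.

Lemma dx_inv_continuous F : cint F -> continuous (dx_inv F).
Proof.
move=> cF x; apply/differentiable_continuous/derivable1_diffP.
by have [] := is_derive_dx_inv x cF.
Qed.

Definition L1norm F : R := \int[mu]_x `|F x|.

Lemma L1norm_ge0 F : 0 <= L1norm F.
Proof. exact: Rintegral_ge0. Qed.

Lemma le_L1norm F : cint F -> `|\int[mu]_x F x| <= L1norm F.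
Proof. by move=> cF; apply: le_normr_Rintegral => //; exact: cint_integrable. Qed.

Lemma dx_inv_le F x : cint F -> `|dx_inv F x| <= L1norm F.
Proof.
move=> cF; have cN := cint_norm cF.
have l1 : `|\int[mu]_(y in `]-oo, x]) F y| <= L1norm F.
  apply: le_trans (le_normr_Rintegral _ _) _ => //; first exact: integrable_sub.
  rewrite -subr_ge0 /L1norm -(Rintegral_split _ cN); exact: Rintegral_ge0.
have l2 : `|\int[mu]_(y in `[x, +oo[) F y| <= L1norm F.
  apply: le_trans (le_normr_Rintegral _ _) _ => //; first exact: integrable_sub.
  by rewrite (Rintegral_split _ cN) lerBlDr lerDl; exact: Rintegral_ge0.
rewrite /dx_inv -mulrBr normrM ger0_norm ?invr_ge0 //.
rewrite ler_pdivrMl // mulr_natl mulr2n; apply: le_trans (ler_normB _ _) _.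
exact: lerD.
Qed.

Lemma cint_mul_dx_inv F G : cint F -> cint G -> cint (fun x => F x * dx_inv G x).
Proof.
move=> cF cG; apply: (@cint_mulb _ _ (L1norm G)) => //; first exact: dx_inv_continuous.
by move=> x; exact: dx_inv_le.
Qed.

Definition nlform F G : R := \int[mu]_x (F x * dx_inv G x).

Lemma nlformDl F F' G : cint F -> cint F' -> cint G ->
  nlform (fun x => F x + F' x) G = nlform F G + nlform F' G.
Proof.
move=> cF cF' cG; rewrite /nlform -RintegralD //; try exact/cint_integrable/cint_mul_dx_inv.
by apply: eq_Rintegral => x _; rewrite mulrDl.
Qed.

Lemma nlformZl k F G : cint F -> cint G -> nlform (fun x => k * F x) G = k * nlform F G.
Proof.
move=> cF cG; rewrite /nlform -RintegralZl //; try exact/cint_integrable/cint_mul_dx_inv.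
by apply: eq_Rintegral => x _; rewrite mulrA.
Qed.

Lemma nlform_le F G : cint F -> cint G -> `|nlform F G| <= L1norm F * L1norm G.
Proof.
move=> cF cG; have cFG := cint_mul_dx_inv cF cG.
apply: le_trans (le_L1norm cFG) _; rewrite /L1norm -RintegralZr //; last exact/cint_integrable/cint_norm.
apply: le_Rintegral => //.
- exact/cint_integrable/cint_norm.
- have := cint_integrable (cintZ (L1norm G) (cint_norm cF)).
  by apply: eq_integrable => // x _ /=; rewrite mulrC.
- by move=> x _; rewrite normrM ler_wpM2l // dx_inv_le.
Qed.

Lemma Rintegral_swap F G : cint F -> cint G ->
  \int[mu]_x (F x * \int[mu]_(y in `]-oo, x]) G y) =
  \int[mu]_y (G y * \int[mu]_(x in `[y, +oo[) F x).
Proof.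
move=> cF cG.
pose S : set (measurableTypeR R * measurableTypeR R) := [set z | z.2 <= z.1].
have mS : measurable S.
  have -> : S = setT `&` (fun z => z.1 - z.2) @^-1` `[0, +oo[.
    by apply/seteqP; split=> z /=; rewrite in_itv /= andbT subr_ge0 // => -[].
  have : measurable_fun setT (fun z : measurableTypeR R * measurableTypeR R => z.1 - z.2 : measurableTypeR R).
    by apply: measurable_funB; [exact: measurable_fst|exact: measurable_snd].
  by apply.
have := Rintegral_swap_section mS (cint_integrable cF) (cint_integrable cG).
have e1 x : xsection S x = `]-oo, x]%classic.
  by apply/seteqP; split=> y; rewrite /xsection /S /= inE /= in_itv.
have e2 y : ysection S y = `[y, +oo[%classic.
  by apply/seteqP; split=> x; rewrite /ysection /S /= inE /= in_itv /= andbT.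
move=> H; transitivity (\int[mu]_x (F x * \int[mu]_(y in xsection S x) G y)).
  by apply: eq_Rintegral => x _; rewrite e1.
by apply: etrans H _; apply: eq_Rintegral => y _; rewrite e2.
Qed.

(** Swapping the order of integration exchanges the lower and upper half-lines, which enter [dx_inv]
    with opposite signs. *)
Lemma nlform_skew F G : cint F -> cint G -> nlform F G = - nlform G F.
Proof.
move=> cF cG.
have half (A B : R -> R) : cint A -> cint B -> nlform A B =
   2^-1 * \int[mu]_x (A x * \int[mu]_(y in `]-oo, x]) B y) -
   2^-1 * \int[mu]_x (A x * \int[mu]_(y in `[x, +oo[) B y).
  move=> cA cB.
  have c1 : cint (fun x => A x * \int[mu]_(y in `]-oo, x]) B y).
    have -> : (fun x => A x * \int[mu]_(y in `]-oo, x]) B y) =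
        (fun x => A x * dx_inv B x + (2^-1 * \int[mu]_y B y) * A x).
      by apply/funext => x; rewrite dx_invE //; ring.
    by apply: cintD; [exact: cint_mul_dx_inv|exact: cintZ].
  have c2 : cint (fun x => A x * \int[mu]_(y in `[x, +oo[) B y).
    have -> : (fun x => A x * \int[mu]_(y in `[x, +oo[) B y) =
        (fun x => (\int[mu]_y B y) * A x + (-1) * (A x * \int[mu]_(y in `]-oo, x]) B y)).
      by apply/funext => x; rewrite Rintegral_split //; ring.
    by apply: cintD; exact: cintZ.
  pose I1 x := A x * \int[mu]_(y in `]-oo, x]) B y.
  pose I2 x := A x * \int[mu]_(y in `[x, +oo[) B y.
  transitivity (\int[mu]_x (2^-1 * I1 x + (- 2^-1) * I2 x)).
    by apply: eq_Rintegral => x _; rewrite /dx_inv /I1 /I2; ring.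
  rewrite (RintegralD measurableT (cint_integrable (cintZ 2^-1 c1))
             (cint_integrable (cintZ (- 2^-1) c2))).
  rewrite (RintegralZl _ measurableT (cint_integrable c1)).
  by rewrite (RintegralZl _ measurableT (cint_integrable c2)) mulNr.
by rewrite !half // (Rintegral_swap cF cG) (Rintegral_swap cG cF); ring.
Qed.

Lemma nlformDr F G G' : cint F -> cint G -> cint G' ->
  nlform F (fun x => G x + G' x) = nlform F G + nlform F G'.
Proof.
move=> cF cG cG'; rewrite !(nlform_skew cF) //; last exact: cintD.
by rewrite nlformDl // opprD.
Qed.

Lemma nlformZr k F G : cint F -> cint G -> nlform F (fun x => k * G x) = k * nlform F G.
Proof.
move=> cF cG; rewrite !(nlform_skew cF) //; last exact: cintZ.
by rewrite nlformZl // mulrN.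
Qed.

Lemma cint_compact_support F (a : R) : continuous F -> (forall x, a < `|x| -> F x = 0) -> cint F.
Proof.
move=> cF F0; split=> //.
have -> : EFin \o F = (EFin \o F) \_ `[- a, a].
  apply/funext => x; rewrite /patch; case: ifPn => // /negP xa.
  rewrite /= F0 // ltNge; apply/negP => xa'; apply: xa.
  by rewrite inE /= in_itv /= -ler_norml.
apply: (iffLR (integrable_mkcond _ _)) => //; apply: continuous_compact_integrable.
  exact: segment_compact.
exact: continuous_subspaceT.
Qed.

(** No integration constant appears: p vanishes at both ends, so the total integral of q is zero. *)
Lemma dx_inv_derivative (p q : R -> R) (a : R) : continuous q ->
  (forall x, is_derive x (1 : R) p (q x)) -> (forall x, a < `|x| -> p x = 0) ->
  (forall x, a < `|x| -> q x = 0) -> dx_inv q = p.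
Proof.
move=> cq dp p0 q0; apply/funext => x; have ciq := cint_compact_support cq q0.
have pc : continuous p.
  by move=> y; apply/differentiable_continuous/derivable1_diffP; have [] := dp y.
(* Strictly beyond both a and |x|, so p(-b) = p(b) = 0 and x lies in the interval. *)
pose b := `|a| + `|x| + 1.
have b0 : 0 < b by rewrite ltr_wpDl // addr_ge0.
have ab : a < b.
  by rewrite /b -addrA; apply: le_lt_trans (ler_norm a) _; rewrite ltrDl ltr_wpDl.
have xb : `|x| < b by rewrite /b addrAC ltrDr ltr_wpDl.
have FTC c : - b < c -> \int[mu]_(y in `[- b, c]) q y = p c.
  move=> bc; rewrite /Rintegral (@continuous_FTC2 R q p) //=.
  - by rewrite [p (- b)]p0 ?subr0 // normrN (gtr0_norm b0).
  - exact: continuous_subspaceT.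
  - split; last 2 first.
    + by apply: cvg_at_right_filter; exact: pc.
    + by apply: cvg_at_left_filter; exact: pc.
    by move=> y _; have [] := dp y.
  - by move=> y _; exact: derive1_val.
have q0b y : y < - b -> q y = 0.
  move=> yb; apply: q0; apply: lt_trans ab _; rewrite ltrNr in yb.
  by apply: lt_le_trans yb _; rewrite -normrN ler_norm.
rewrite dx_invE //.
have -> : \int[mu]_y q y = 0.
  transitivity (\int[mu]_(y in `[- b, b]) q y).
    rewrite [RHS]Rintegral_mkcond; apply: eq_Rintegral => y _; rewrite /patch.
    case: ifPn => // /negP yb; rewrite q0 // (lt_trans ab) // ltNge; apply/negP => yb'.
    by apply: yb; rewrite inE /= in_itv /= -ler_norml.
  by rewrite FTC ?gtrN // p0 // (gtr0_norm b0).
rewrite mulr0 subr0 -FTC; last by move: xb; rewrite ltr_norml => /andP[].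
rewrite [LHS]Rintegral_mkcond [RHS]Rintegral_mkcond; apply: eq_Rintegral => y _.
rewrite /patch; have [yx|yx] := boolP (y \in `]-oo, x]%classic); last first.
  rewrite ifN //; apply: contra yx; rewrite !inE /= !in_itv /=; by case/andP.
case: ifPn => // /negP yb; apply: q0b; rewrite ltNge; apply/negP => yb'; apply: yb.
by move: yx; rewrite !inE /= !in_itv /= => ->; rewrite yb'.
Qed.

Lemma nlform_derivative (p q G : R -> R) (a : R) : cint G -> continuous q ->
  (forall x, is_derive x (1 : R) p (q x)) -> (forall x, a < `|x| -> p x = 0) ->
  (forall x, a < `|x| -> q x = 0) ->
  nlform q G = - \int[mu]_x (G x * p x).
Proof.
move=> cG cq dp p0 q0; rewrite nlform_skew //; last exact: cint_compact_support q0.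
by rewrite /nlform (dx_inv_derivative cq dp p0 q0).
Qed.

End NonlocalForm.

(** * Differentiation of the nonlocal form *)
Section NonlocalFormDerivative.
Variable R : realType.
Local Notation mu := (@lebesgue_measure R).

Lemma is_derive_remainder (f : R -> R) (d : R) :
  (forall e : R, 0 < e -> \forall s \near (0 : R), `|f s - f 0 - s * d| <= e * `|s|) ->
  is_derive (0 : R) (1 : R) f d.
Proof.
move=> H; suff L : h^-1 *: ((f \o shift 0) (h *: (1 : R)) - f 0) @[h --> 0^'] --> d.
  by apply: DeriveDef; [apply: cvgP L | exact: cvg_lim L].
apply/cvgrPdist_le => e e0; near=> h.
have h0 : h != 0 by near: h; exact: nbhs_dnbhs_neq.
rewrite /= addr0 [h *: 1]mulr1.
have -> : d - h^-1 *: (f h - f 0) = - (h^-1 * (f h - f 0 - h * d)).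
  by rewrite /GRing.scale /=; field.
rewrite normrN normrM normfV ler_pdivrMl ?normr_gt0 // [leRHS]mulrC.
by near: h; apply: nbhs_dnbhs; exact: H.
Unshelve. all: by end_near. Qed.

(** Differentiability at s = 0 of a curve in the L^1 norm. The neighbourhood contains 0, so
    integrability of [F 0] is included. *)
Definition L1_derivable (F : R -> R -> R) (dF : R -> R) := cint dF /\
  forall e : R, 0 < e -> \forall s \near (0 : R),
    cint (F s) /\ L1norm (fun x => F s x - F 0 x - s * dF x) <= e * `|s|.

Lemma nlform_is_derive (F G : R -> R -> R) (dF dG : R -> R) :
  L1_derivable F dF -> L1_derivable G dG ->
  is_derive (0 : R) (1 : R) (fun s => nlform (F s) (G s))
    (nlform dF (G 0) + nlform (F 0) dG).
Proof.
move=> [cdF HF] [cdG HG].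
have cF0 : cint (F 0) by have := HF 1 ltr01 => /nbhs_singleton[].
have cG0 : cint (G 0) by have := HG 1 ltr01 => /nbhs_singleton[].
apply: is_derive_remainder => e e0.
set nF := L1norm (F 0); set nG := L1norm (G 0); set mF := L1norm dF; set mG := L1norm dG.
have nF0 : 0 <= nF by exact: L1norm_ge0.
have nG0 : 0 <= nG by exact: L1norm_ge0.
have mF0 : 0 <= mF by exact: L1norm_ge0.
have mG0 : 0 <= mG by exact: L1norm_ge0.
(* With |s| <= e1 <= 1, each error term of the bilinear expansion is at most e1 |s| times one
   summand of C; the summand 1 absorbs the product of the two remainders. *)
pose C := nF + nG + mF * mG + mF + mG + 1.
have C0 : 0 < C by rewrite /C; have := mulr_ge0 mF0 mG0; lra.
pose e1 := Num.min 1 (e / C).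
have e10 : 0 < e1 by rewrite /e1 lt_min ltr01 divr_gt0.
have e11 : e1 <= 1 by rewrite /e1 ge_min lexx.
have e1C : e1 * C <= e by rewrite -ler_pdivlMr // /e1 ge_min lexx orbT.
near=> s.
have [cFs rF] : cint (F s) /\ L1norm (fun x => F s x - F 0 x - s * dF x) <= e1 * `|s|.
  by near: s; exact: HF.
have [cGs rG] : cint (G s) /\ L1norm (fun x => G s x - G 0 x - s * dG x) <= e1 * `|s|.
  by near: s; exact: HG.
have s1 : `|s| <= e1.
  by near: s; have := @nbhs0_le _ R _ e10.
pose r x := F s x + (- 1) * (F 0 x + s * dF x).
pose r' x := G s x + (- 1) * (G 0 x + s * dG x).
have cr : cint r by apply: cintD => //; apply: cintZ; apply: cintD => //; exact: cintZ.
have cr' : cint r' by apply: cintD => //; apply: cintZ; apply: cintD => //; exact: cintZ.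
have nr : L1norm r <= e1 * `|s|.
  apply: le_trans rF; rewrite le_eqVlt; apply/orP; left; apply/eqP.
  by apply: eq_Rintegral => x _; congr `|_|; rewrite /r; ring.
have nr' : L1norm r' <= e1 * `|s|.
  apply: le_trans rG; rewrite le_eqVlt; apply/orP; left; apply/eqP.
  by apply: eq_Rintegral => x _; congr `|_|; rewrite /r'; ring.
have FE : F s = (fun x => (F 0 x + s * dF x) + r x) by apply/funext => x; rewrite /r; ring.
have GE : G s = (fun x => (G 0 x + s * dG x) + r' x) by apply/funext => x; rewrite /r'; ring.
have csF : cint (fun x => s * dF x) by exact: cintZ.
have csG : cint (fun x => s * dG x) by exact: cintZ.
have cF1 : cint (fun x => F 0 x + s * dF x) by exact: cintD.
have cG1 : cint (fun x => G 0 x + s * dG x) by exact: cintD.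
have EE : nlform (F s) (G s) = nlform (F 0) (G 0) + s * (nlform dF (G 0) + nlform (F 0) dG)
   + (s * s * nlform dF dG + (nlform r (G 0) + s * nlform r dG + nlform r r')
      + (nlform (F 0) r' + s * nlform dF r')).
  have D3 A : cint A -> nlform A (fun x => G 0 x + s * dG x + r' x) =
      nlform A (G 0) + s * nlform A dG + nlform A r'.
    by move=> cA; rewrite (nlformDr cA cG1 cr') (nlformDr cA cG0 csG) (nlformZr _ cA cdG).
  have cGr := cintD cG1 cr'.
  rewrite FE GE (nlformDl cF1 cr cGr) (nlformDl cF0 csF cGr) (nlformZl _ cdF cGr) !D3 //.
  move: (nlform (F 0) (G 0)) (nlform (F 0) dG) (nlform (F 0) r') (nlform dF (G 0))
    (nlform dF dG) (nlform dF r') (nlform r (G 0)) (nlform r dG) (nlform r r').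
  by clear => *; ring.
rewrite EE; set d := nlform dF (G 0) + _.
have B (A A' : R -> R) (x y : R) : cint A -> cint A' -> L1norm A <= x -> L1norm A' <= y ->
    `|nlform A A'| <= x * y.
  move=> cA cA' Ax Ay; apply: le_trans (nlform_le cA cA') _.
  by apply: ler_pM => //; exact: L1norm_ge0.
have b1 := B _ _ _ _ cdF cdG (lexx _) (lexx _).
have b2 := B _ _ _ _ cr cG0 nr (lexx _).
have b3 := B _ _ _ _ cr cdG nr (lexx _).
have b4 := B _ _ _ _ cr cr' nr nr'.
have b5 := B _ _ _ _ cF0 cr' (lexx _) nr'.
have b6 := B _ _ _ _ cdF cr' (lexx _) nr'.
rewrite -/mF -/mG -/nG -/nF in b1 b2 b3 b5 b6.
move: (nlform (F 0) (G 0)) d (nlform dF dG) (nlform r (G 0)) (nlform r dG) (nlform r r')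
  (nlform (F 0) r') (nlform dF r') b1 b2 b3 b4 b5 b6 => z d x1 x2 x3 x4 x5 x6 b1 b2 b3 b4 b5 b6.
have -> : z + s * d + (s * s * x1 + (x2 + s * x3 + x4) + (x5 + s * x6)) - z - s * d =
   s * s * x1 + (x2 + s * x3 + x4) + (x5 + s * x6) by ring.
set t := `|s| in s1 b2 b3 b4 b5 b6 *; have t0 : 0 <= t by exact: normr_ge0.
apply: (@le_trans _ _ (t * t * (mF * mG) + (e1 * t * nG + t * (e1 * t * mG) + e1 * t * (e1 * t))
   + (nF * (e1 * t) + t * (mF * (e1 * t))))).
  have N (x y k : R) : `|y| <= k -> `|x * y| <= `|x| * k by move=> yk; rewrite normrM ler_wpM2l.
  apply: le_trans (ler_normD _ _) _; apply: lerD; last first.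
    by apply: le_trans (ler_normD _ _) _; apply: lerD => //; exact: N.
  apply: le_trans (ler_normD _ _) _; apply: lerD.
    by have := N (s * s) _ _ b1; rewrite [`|s * s|]normrM.
  apply: le_trans (ler_normD _ _) _; apply: lerD => //.
  by apply: le_trans (ler_normD _ _) _; apply: lerD => //; exact: N.
apply: (@le_trans _ _ (e1 * C * t)); last by rewrite ler_wpM2r.
have t1 : t <= 1 by apply: le_trans s1 e11.
have k1 : t * t * (mF * mG) <= e1 * t * (mF * mG).
  by rewrite ler_wpM2r ?mulr_ge0 // ler_wpM2r.
have k2 : t * (e1 * t * mG) <= e1 * t * mG.
  by rewrite -[leRHS]mul1r ler_wpM2r // !mulr_ge0 // ltW.
have k3 : e1 * t * (e1 * t) <= e1 * t.
  have et0 : 0 <= e1 * t by rewrite mulr_ge0 // ltW.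
  by rewrite ler_piMr // mulr_ile1 // ltW.
have k4 : t * (mF * (e1 * t)) <= mF * (e1 * t).
  by rewrite -[leRHS]mul1r ler_wpM2r // !mulr_ge0 // ltW.
have -> : e1 * C * t = e1 * t * (mF * mG) + (e1 * t * nG + e1 * t * mG + e1 * t)
   + (nF * (e1 * t) + mF * (e1 * t)) by rewrite /C; ring.
by apply: lerD; [apply: lerD => //; apply: lerD => //; apply: lerD|apply: lerD].
Unshelve. all: by end_near. Qed.

(** By the mean value theorem in s the remainder is s (psi t x - psi 0 x) for some t between 0 and
    s. Compactness of the interval makes the local estimates near each (x0, 0) uniform in x. *)
Lemma uniform_remainder (F psi : R -> R -> R) (a : R) :
  (forall x0, `|x0| <= a -> \forall z \near (x0, 0 : R),
     is_derive z.2 (1 : R) (fun s => F s z.1) (psi z.2 z.1)) ->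
  (forall x0, `|x0| <= a -> psi z.2 z.1 @[z --> (x0, 0 : R)] --> psi 0 x0) ->
  continuous (psi 0) ->
  forall e : R, 0 < e -> \forall s \near (0 : R), forall x, `|x| <= a ->
    `|F s x - F 0 x - s * psi 0 x| <= e * `|s|.
Proof.
move=> H1 H2 c0 e e0.
pose Q s x := is_derive s (1 : R) (fun s => F s x) (psi s x) /\ `|psi s x - psi 0 x| <= e.
have /compact_near_coveringP K := @segment_compact R (- a) a.
have : \forall s \near (0 : R), `[- a, a]%classic `<=` Q s.
  apply: (K R (nbhs (0 : R)) Q) => x0; rewrite /= in_itv /= -ler_norml => x0a.
  have e2 : 0 < e / 2 by rewrite divr_gt0.
  have n1 := H1 x0 x0a.
  have n2 : \forall z \near (x0, 0 : R), `|psi 0 x0 - psi z.2 z.1| <= e / 2.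
    by move/cvgrPdist_le: (H2 x0 x0a) => /(_ _ e2).
  have n3 : \forall z \near (x0, 0 : R), `|psi 0 x0 - psi 0 z.1| <= e / 2.
    have : psi 0 z.1 @[z --> (x0, 0 : R)] --> psi 0 x0.
      by apply: (@cvg_comp _ _ _ (fst : R * R -> R) (psi 0) _ (nbhs x0)); [exact: cvg_fst|exact: c0].
    by move/cvgrPdist_le => /(_ _ e2).
  apply: filterS (filterI n1 (filterI n2 n3)) => z [z1 [z2 z3]]; split=> //.
  have -> : psi z.2 z.1 - psi 0 z.1 = (psi 0 x0 - psi 0 z.1) - (psi 0 x0 - psi z.2 z.1) by ring.
  apply: le_trans (ler_normB _ _) _; rewrite (splitr e); exact: lerD.
move=> /nbhs_ballP[d /= d0 dP]; apply/nbhs_ballP; exists d => //= s.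
rewrite -ball_normE /ball_ /= sub0r normrN => sd x xa.
have Qs t : `|t| <= `|s| -> Q t x.
  move=> ts; apply: dP; last by rewrite /= in_itv /= -ler_norml.
  by rewrite -ball_normE /ball_ /= sub0r normrN; exact: le_lt_trans sd.
have cF b c : (forall t, t \in `[b, c] -> `|t| <= `|s|) -> {within `[b, c], continuous (fun t => F t x)}.
  move=> bc; apply: derivable_within_continuous => t tbc.
  by have [[]] := Qs t (bc t tbc).
have fin t : `|t| <= `|s| -> F s x - F 0 x = psi t x * s -> `|F s x - F 0 x - s * psi 0 x| <= e * `|s|.
  move=> ts ->; have -> : psi t x * s - s * psi 0 x = (psi t x - psi 0 x) * s by ring.
  by rewrite normrM ler_wpM2r //; have [] := Qs t ts.
have [s0|s0] := leP 0 s.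
  have rng t : t \in `[0, s] -> `|t| <= `|s|.
    by rewrite in_itv /= => /andP[t0 ts]; rewrite !ger0_norm.
  have [t tI tE] := @MVT_segment R (fun t => F t x) (fun t => psi t x) 0 s s0
    (fun t tI => (Qs t (rng t (subset_itv_oo_cc tI))).1) (cF _ _ rng).
  by apply: (fin t (rng t tI)); rewrite tE subr0.
have rng t : t \in `[s, 0] -> `|t| <= `|s|.
  by rewrite in_itv /= => /andP[t0 ts]; rewrite !ler0_norm ?lerN2 // ltW.
have [t tI tE] := @MVT_segment R (fun t => F t x) (fun t => psi t x) s 0 (ltW s0)
  (fun t tI => (Qs t (rng t (subset_itv_oo_cc tI))).1) (cF _ _ rng).
by apply: (fin t (rng t tI)); rewrite -opprB tE; ring.
Qed.

(** The family does not move outside the interval, so a uniform remainder bound costs only the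
    factor 2a in the L^1 norm. *)
Lemma L1_derivable_uniform (F : R -> R -> R) (dF : R -> R) (a : R) : 0 <= a ->
  continuous dF -> (forall x, a < `|x| -> dF x = 0) ->
  (\forall s \near (0 : R), continuous (F s)) -> cint (F 0) ->
  (forall s x, a < `|x| -> F s x = F 0 x) ->
  (forall e : R, 0 < e -> \forall s \near (0 : R), forall x, `|x| <= a ->
    `|F s x - F 0 x - s * dF x| <= e * `|s|) ->
  L1_derivable F dF.
Proof.
move=> a0 cdF dF0 cF cF0 FF H; split; first exact: cint_compact_support dF0.
move=> e e0; pose e1 := e / (2 * a + 1).
have a1 : 0 < 2 * a + 1 by rewrite ltr_wpDl // mulr_ge0.
have e10 : 0 < e1 by rewrite divr_gt0.
near=> s.
have cFs : continuous (F s) by near: s.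
have Hs : forall x, `|x| <= a -> `|F s x - F 0 x - s * dF x| <= e1 * `|s| by near: s; exact: H.
have cD : cint (fun x => F s x + (-1) * F 0 x).
  apply: (@cint_compact_support _ _ a); last by move=> x xa; rewrite FF //; ring.
  have c2 := (cintZ (-1) cF0).1.
  by move=> x; exact: (continuousD (cFs x) (c2 x)).
split.
  have -> : F s = (fun x => (F s x + (-1) * F 0 x) + F 0 x) by apply/funext => x; ring.
  exact: cintD.
pose r x := F s x - F 0 x - s * dF x.
have cr : cint r.
  have -> : r = (fun x => (F s x + (-1) * F 0 x) + (- s) * dF x) by apply/funext => x; rewrite /r; ring.
  by apply: cintD => //; apply: cintZ; exact: cint_compact_support dF0.
have r0 x : a < `|x| -> r x = 0 by move=> xa; rewrite /r FF // dF0 //; ring.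
have -> : L1norm (fun x => F s x - F 0 x - s * dF x) = \int[mu]_(x in `[- a, a]) `|r x|.
  rewrite [RHS]Rintegral_mkcond; apply: eq_Rintegral => x _; rewrite /patch.
  case: ifPn => // /negP xa; rewrite -/(r x) r0 ?normr0 // ltNge; apply/negP => xa'; apply: xa.
  by rewrite inE /= in_itv /= -ler_norml.
have mA : mu [set` `[- a, a]] = (2 * a)%:E.
  rewrite lebesgue_measure_itv /= lte_fin; case: ltP => aa; first by rewrite -EFinB opprK -mulr2n mulr_natl.
  suff -> : a = 0 by rewrite mulr0.
  by apply/le_anti; rewrite a0 andbT (le_trans aa) // oppr_le0.
apply: (@le_trans _ _ (\int[mu]_(x in `[- a, a]) (e1 * `|s|))).
  apply: le_Rintegral => //.
  - exact: (integrable_sub _ (cint_norm cr)).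
  - by apply: measurable_bounded_integrable => //; [exact: (eq_ind_r (fun z => (z < +oo)%E) (ltry _) mA)|exact: bounded_cst].
  - by move=> x /=; rewrite in_itv /= -ler_norml => xa; exact: Hs.
rewrite Rintegral_cst // (_ : fine _ = 2 * a); last exact: (congr1 fine mA).
rewrite mulrAC ler_wpM2r // /e1 mulrAC ler_pdivrMr // ler_wpM2l 1?ltW //.
by rewrite ltrDl.
Unshelve. all: by end_near. Qed.

End NonlocalFormDerivative.

(** * The Hamiltonian property *)
Lemma cancel_common (R : realType) (h c t1 t2 t3 t4 : R) :
  t1 - t2 = t3 - t4 -> h + t1 + (- c - t2) = h + t3 + (- c - t4).
Proof. by move=> H; lra. Qed.

(** * Exterior derivatives of the pulled-back differentials *)

Section CurlSymmetry.
Variables (R : realType) (n : nat) (U : set 'rV[R]_n) (m : nat).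
Hypothesis oU : open U.
Variable W : 'I_m -> 'rV[R]_n -> 'M[R]_n.
Hypothesis dW : forall a i j u, U u -> differentiable (fun v => W a v i j) u.
Hypothesis WC : forall a b u, U u -> W a u *m W b u = W b u *m W a u.
Hypothesis WF : forall a b u Y, U u ->
  flow_form (W a) (W b) u Y Y = flow_form (W b) (W a) u Y Y.
Variable f : 'rV[R]_n -> R.
Hypothesis sf : smooth_on U f.

(** The components of the one-form df composed with W_a; [curl] is its exterior derivative and
    [curl_form] the latter on two vectors. *)
Definition pullback (a : 'I_m) (k : 'I_n) (v : 'rV[R]_n) : R :=
  \sum_i W a v i k * pd i f v.

Definition curl (a : 'I_m) (r l : 'I_n) (v : 'rV[R]_n) : R :=
  pd r (pullback a l) v - pd l (pullback a r) v.

Definition curl_form (a : 'I_m) (u A B : 'rV[R]_n) : R :=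
  \sum_r A 0 r * \sum_l curl a r l u * B 0 l.

Let df (v : 'rV[R]_n) : 'rV[R]_n := \row_i pd i f v.

Let mdW a u : U u -> mx_pderivable (W a) u.
Proof. by move=> Uu i j; apply: diff_pderivable; exact: dW. Qed.

Let mdf u : U u -> mx_pderivable df u.
Proof.
move=> Uu i j; have -> : (fun v => df v i j) = pd j f by apply/funext => v; rewrite mxE.
by apply: diff_pderivable; exact: (sf [:: j]).
Qed.

Lemma curl_formE a u A B : U u ->
  curl_form a u A B =
  (dirmx df u A *m W a u *m B^T + df u *m dirmx (W a) u A *m B^T
   - (dirmx df u B *m W a u *m A^T + df u *m dirmx (W a) u B *m A^T)) 0 0.
Proof.
move=> Uu; rewrite -!mulmxDl -!(dirmxM _ (mdf Uu) (@mdW a u Uu)).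
have pE l : pullback a l = (fun v => (df v *m W a v) 0 l).
  by apply/funext => v; rewrite /pullback mxE; apply: eq_bigr => i _; rewrite mxE mulrC.
rewrite [RHS]mxE [X in _ = _ + X]mxE [X in _ = X - _]mxE [X in _ = _ - X]mxE.
have -> : \sum_j dirmx (fun v => df v *m W a v) u B 0 j * A^T j 0 =
    \sum_r \sum_l A 0 r * pd l (pullback a r) u * B 0 l.
  apply: eq_bigr => r _; rewrite !mxE mulr_suml; apply: eq_bigr => l _.
  by rewrite pE; ring.
have -> : \sum_j dirmx (fun v => df v *m W a v) u A 0 j * B^T j 0 =
    \sum_r \sum_l A 0 r * pd r (pullback a l) u * B 0 l.
  rewrite exchange_big; apply: eq_bigr => l _; rewrite !mxE mulr_suml; apply: eq_bigr => r _.
  by rewrite pE; ring.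
rewrite -sumrB; apply: eq_bigr => r _; rewrite mulr_sumr -sumrB; apply: eq_bigr => l _.
by rewrite /curl; ring.
Qed.

Lemma hessian_sym u A B : U u ->
  (dirmx df u A *m B^T) 0 0 = (dirmx df u B *m A^T) 0 0.
Proof.
move=> Uu; rewrite !mxE.
under eq_bigr => l _ do rewrite !mxE mulr_suml.
under [RHS]eq_bigr => l _ do rewrite !mxE mulr_suml.
rewrite exchange_big; apply: eq_bigr => l _ /=; apply: eq_bigr => r _.
have dE i : (fun v => df v 0 i) = pd i f by apply/funext => v; rewrite mxE.
by rewrite !dE (pd_sym r l oU sf Uu); ring.
Qed.

(** Of the four terms of [curl_formE], one is the Hessian of f on (W_b Y, W_a Y), one is unchanged
    because the affinors commute, and the two that differentiate the affinors are treated together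
    in [th]. *)
Lemma curl_form_sym a b u Y : U u ->
  curl_form a u (Y *m (W b u)^T) Y = curl_form b u (Y *m (W a u)^T) Y.
Proof.
move=> Uu; rewrite !curl_formE //.
have /(congr1 trmx) := WF a b Y Uu.
rewrite /flow_form !linearD /= !trmx_mul !trmxK => FF.
have := @dirmx_open _ _ U _ _ (fun v => W a v *m W b v) (fun v => W b v *m W a v) u Y oU Uu
  (fun v Uv => WC a b Uv).
rewrite !dirmxM; try exact: mdW.
move=> /(congr1 (fun M => M *m Y^T)); rewrite !mulmxDl => CC.
(* The flow relation reads x1 + x2 = x3 + x4, and the derivative along Y of W_a W_b = W_b W_a reads
   x5 + x2 = x6 + x4; their difference is the claim. *)
have th : df u *m dirmx (W a) u (Y *m (W b u)^T) *m Y^T - df u *m dirmx (W a) u Y *m (W b u *m Y^T) =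
   df u *m dirmx (W b) u (Y *m (W a u)^T) *m Y^T - df u *m dirmx (W b) u Y *m (W a u *m Y^T).
  rewrite -!mulmxA -!mulmxBr; congr (_ *m _).
  move: FF CC; rewrite -!mulmxA.
  set x1 := dirmx (W a) u (Y *m (W b u)^T) *m Y^T.
  set x2 := W a u *m (dirmx (W b) u Y *m Y^T).
  set x3 := dirmx (W b) u (Y *m (W a u)^T) *m Y^T.
  set x4 := W b u *m (dirmx (W a) u Y *m Y^T).
  set x5 := dirmx (W a) u Y *m (W b u *m Y^T).
  set x6 := dirmx (W b) u Y *m (W a u *m Y^T).
  clearbody x1 x2 x3 x4 x5 x6.
  move=> FF CC; apply/eqP; rewrite subr_eq; apply/eqP; apply: (addIr x2).
  by rewrite FF -addrA CC addrA subrK.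
have hs : (dirmx df u (Y *m (W b u)^T) *m W a u *m Y^T) 0 0 =
    (dirmx df u (Y *m (W a u)^T) *m W b u *m Y^T) 0 0.
  have e c : W c u *m Y^T = (Y *m (W c u)^T)^T by rewrite trmx_mul trmxK.
  by rewrite -!mulmxA !e hessian_sym.
have cs : dirmx df u Y *m W a u *m (W b u *m Y^T) = dirmx df u Y *m W b u *m (W a u *m Y^T).
  by rewrite !mulmxA -[_ *m W a u *m W b u]mulmxA WC // !mulmxA.
rewrite cs.
have add00 (A B : 'M[R]_1) : (A + B) 0 0 = A 0 0 + B 0 0 by rewrite mxE.
have opp00 (A : 'M[R]_1) : (- A) 0 0 = - A 0 0 by rewrite mxE.
have := congr1 (fun M : 'M[R]_1 => M 0 0) th; rewrite !(add00, opp00) hs.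
exact: cancel_common.
Qed.

End CurlSymmetry.

(** * One-forms along a curve and their first variation *)

Section Curves.
Variables (R : realType) (n : nat) (U : set 'rV[R]_n).
Local Notation mu := (@lebesgue_measure R).

Lemma continuous_at_sum (T : topologicalType) p (F : 'I_p -> T -> R) (x : T) :
  (forall i, {for x, continuous (F i)}) -> {for x, continuous (fun y => \sum_i F i y)}.
Proof.
move=> cF; elim: p F cF => [|p IH] F cF.
  have -> : (fun y => \sum_(i < 0) F i y) = fun=> 0.
    by apply/funext => y; rewrite big_ord0.
  exact: cst_continuous.
have -> : (fun y => \sum_(i < p.+1) F i y) =
    (fun y => F ord0 y + \sum_(i < p) F (lift ord0 i) y).
  by apply/funext => y; rewrite big_ord_recl.
by apply: continuousD => //; apply: IH.
Qed.

Lemma continuous_at_comp (S T V : topologicalType) (f : S -> T) (h : T -> V) (x : S) :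
  {for x, continuous f} -> {for f x, continuous h} -> {for x, continuous (fun y => h (f y))}.
Proof. by move=> cf ch; exact: (continuous_comp cf ch). Qed.

Lemma continuous_at_coord (T : topologicalType) (c : T -> 'rV[R]_n) (x : T) l :
  {for x, continuous c} -> {for x, continuous (fun y => c y 0 l)}.
Proof. by move=> cc; exact: (continuous_at_comp cc (@coord_continuous _ _ _ 0 l _)). Qed.

Definition line_form (p : 'I_n -> 'rV[R]_n -> R) (c w : R -> 'rV[R]_n) (x : R) : R :=
  \sum_l p l (c x) * w x 0 l.

Lemma line_form_continuous p c w : (forall l u, U u -> {for u, continuous (p l)}) ->
  continuous c -> continuous w -> (forall x, U (c x)) -> continuous (line_form p c w).
Proof.
move=> cp cc cw Uc x; apply: continuous_at_sum => l; apply: continuousM.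
  by apply: (continuous_at_comp (cc x)); exact: cp.
by apply: continuous_at_coord; exact: cw.
Qed.

Variable u : R -> 'rV[R]_n.
Hypothesis pu : phase_space U u.

Lemma phase_derive x : is_derive x (1 : R) u (derive1 u x).
Proof. by have [su _ _ _] := pu; exact: (smooth_curve_derive 0). Qed.

Lemma derivable_curve_continuous (c c' : R -> 'rV[R]_n) :
  (forall x, is_derive x (1 : R) c (c' x)) -> continuous c.
Proof.
by move=> dc x; apply/differentiable_continuous/derivable1_diffP; have [] := dc x.
Qed.

Lemma smooth_derive1_continuous (c : R -> 'rV[R]_n) : smooth_curve c -> continuous (derive1 c).
Proof. by move=> sc; apply: derivable_curve_continuous (fun x => smooth_curve_derive 1 x sc). Qed.

Lemma phase_continuous : continuous u.
Proof. exact: derivable_curve_continuous phase_derive. Qed.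

Lemma phase_derive_continuous : continuous (derive1 u).
Proof. by have [su _ _ _] := pu; exact: smooth_derive1_continuous. Qed.

Lemma phase_in x : U (u x).
Proof. by have [_ [K [_ KU uK]] _ _] := pu; apply: KU. Qed.

Lemma coord_le_norm (v : 'rV[R]_n) l : `|v 0 l| <= `|v|.
Proof. by rewrite [leRHS]mx_normrE; apply: (le_bigmax _ _ (0, l)). Qed.

Lemma phase_bounded (p : 'rV[R]_n -> R) : (forall u, U u -> {for u, continuous p}) ->
  exists M, forall x, `|p (u x)| <= M.
Proof.
move=> cp; have [_ [K [cK KU uK]] _ _] := pu.
have cpK : {within K, continuous p}.
  by apply: continuous_in_subspaceT => v /set_mem Kv; apply: cp; exact: KU.
have /compact_bounded[M [_ HM]] := continuous_compact cpK cK.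
exists (M + 1) => x; apply: HM; first by rewrite ltrDl.
by exists (u x).
Qed.

Lemma phase_derive_cint l : cint (fun x => derive1 u x 0 l).
Proof.
have [su _ _ iu] := pu.
apply: (@cint_dom _ _ (fun x => `|derive1 u x|)).
- by move=> x; apply: continuous_at_coord; exact: phase_derive_continuous.
- split=> // x; apply: (@continuous_comp _ _ _ (derive1 u) (fun v : 'rV[R]_n => `|v|)).
    exact: phase_derive_continuous.
  exact: norm_continuous.
- by move=> x; rewrite normr_id; exact: coord_le_norm.
Qed.

Lemma line_form_cint p : (forall l u, U u -> {for u, continuous (p l)}) ->
  cint (line_form p u (derive1 u)).
Proof.
move=> cp; apply: cint_sum => l; have [M HM] := phase_bounded (cp l).
have -> : (fun x => p l (u x) * derive1 u x 0 l) = (fun x => derive1 u x 0 l * p l (u x)).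
  by apply/funext => x; rewrite mulrC.
apply: (cint_mulb (phase_derive_cint l)) HM => x.
by apply: (continuous_at_comp (@phase_continuous x)); apply: cp; exact: phase_in.
Qed.

Lemma line_form_bounded p : (forall l u, U u -> {for u, continuous (p l)}) ->
  exists M, forall x, `|line_form p u (derive1 u) x| <= M.
Proof.
move=> cp; have [_ _ [D HD] _] := pu.
have /choice[M HM] l := phase_bounded (cp l).
exists (\sum_l M l * D) => x; apply: le_trans (ler_norm_sum _ _ _) _.
apply: ler_sum => l _; rewrite normrM; apply: ler_pM => //.
by apply: le_trans (coord_le_norm _ _) (HD x).
Qed.

Variables (v : R -> 'rV[R]_n) (a : R).
Hypotheses (sv : smooth_curve v) (a0 : 0 <= a).
Hypothesis v0 : forall x, a < `|x| -> v x = 0.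
Hypothesis oU : open U.

Let dv x : is_derive x (1 : R) v (derive1 v x).
Proof. exact: (smooth_curve_derive 0). Qed.

Let cv : continuous v.
Proof. exact: derivable_curve_continuous dv. Qed.

Let cdv : continuous (derive1 v).
Proof. exact: smooth_derive1_continuous. Qed.

Lemma test_derive0 x : a < `|x| -> derive1 v x = 0.
Proof.
move=> ax; rewrite derive1E (@near_eq_derive _ _ _ v (cst 0)) ?derive_cst //.
have /filterS : nbhs x [set y | a < `|y|].
  apply/nbhs_ballP; exists (`|x| - a); rewrite /= ?subr_gt0 // => y.
  rewrite -ball_normE /ball_ /= => xy; have := lerB_dist x y.
  by move: xy; move: (`|x|) (`|y|) (`|x - y|) => *; lra.
by apply=> y ay; rewrite v0.
Qed.

Lemma variation_derive1 s x :
  derive1 (fun y => u y + s *: v y) x = derive1 u x + s *: derive1 v x.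
Proof.
apply: derive1_val; have := is_deriveD (phase_derive x) (is_deriveZ s (dv x)).
by [].
Qed.

Lemma variation_cvg (x0 : R) : u z.1 + z.2 *: v z.1 @[z --> (x0, 0 : R)] --> u x0.
Proof.
have -> : u x0 = u x0 + 0 *: v x0 by rewrite scale0r addr0.
apply: cvgD.
  by apply: (@cvg_comp _ _ _ (fst : R * R -> R) u _ (nbhs x0)); [exact: cvg_fst|exact: phase_continuous].
apply: cvgZ; first exact: cvg_snd.
by apply: (@cvg_comp _ _ _ (fst : R * R -> R) v _ (nbhs x0)); [exact: cvg_fst|exact: cv].
Qed.

Lemma variation_near_in (x0 : R) : \forall z \near (x0, 0 : R), U (u z.1 + z.2 *: v z.1).
Proof.
have UN : nbhs (u x0) U by apply: open_nbhs_nbhs; split=> //; exact: phase_in.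
exact: (variation_cvg UN).
Qed.

(** On the support interval of v compactness applies; elsewhere the curve is u itself. *)
Lemma variation_in : \forall s \near (0 : R), forall x, U (u x + s *: v x).
Proof.
have /compact_near_coveringP K := @segment_compact R (- a) a.
have : \forall s \near (0 : R), `[- a, a]%classic `<=` (fun x => U (u x + s *: v x)).
  apply: (K R (nbhs (0 : R)) (fun s x => U (u x + s *: v x))) => x0 _.
  exact: variation_near_in.
apply: filterS => s Hs x; have [ax|xa] := ltP a `|x|.
  by rewrite v0 // scaler0 addr0; exact: phase_in.
by apply: Hs; rewrite /= in_itv /= -ler_norml.
Qed.

Section Variation.
Variable p : 'I_n -> 'rV[R]_n -> R.
Hypothesis Cp : forall l, C1_on U (p l).

(** The s-derivative of [line_form p] along u + s v, needed also for s other than 0 by the mean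
    value argument. *)
Definition variation s x : R :=
  \sum_l ((\sum_r v x 0 r * pd r (p l) (u x + s *: v x)) * (derive1 u x + s *: derive1 v x) 0 l
          + p l (u x + s *: v x) * derive1 v x 0 l).

Let cp l w : U w -> {for w, continuous (p l)}.
Proof. exact: C1_cont. Qed.

Let cdp l r w : U w -> {for w, continuous (pd r (p l))}.
Proof. by move=> Uw; have [_] := Cp l Uw; exact. Qed.

Lemma variation_cvg_at (x0 : R) : variation z.2 z.1 @[z --> (x0, 0 : R)] --> variation 0 x0.
Proof.
have cu : {for (x0, 0 : R), continuous (fun z : R * R => u z.1 + z.2 *: v z.1)}.
  by rewrite /prop_for /continuous_at /= scale0r addr0; exact: variation_cvg.
have U0 : U (u x0 + 0 *: v x0) by rewrite scale0r addr0; exact: phase_in.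
have fstc (w : R -> 'rV[R]_n) : continuous w -> {for (x0, 0 : R), continuous (fun z : R * R => w z.1)}.
  move=> cw; apply: (@cvg_comp _ _ _ (fst : R * R -> R) w _ (nbhs x0)); [exact: cvg_fst|exact: cw].
have cdu : {for (x0, 0 : R), continuous (fun z : R * R => derive1 u z.1 + z.2 *: derive1 v z.1)}.
  apply: continuousD; first exact: (fstc _ phase_derive_continuous).
  by apply: cvgZ; [exact: cvg_snd|exact: (fstc _ cdv)].
suff : {for (x0, 0 : R), continuous (fun z : R * R => variation z.2 z.1)} by [].
apply: continuous_at_sum => l; apply: continuousD; apply: continuousM.
- apply: continuous_at_sum => r; apply: continuousM.
    by apply: continuous_at_coord; exact: (fstc _ cv).
  by apply: (@continuous_comp _ _ _ (fun z : R * R => u z.1 + z.2 *: v z.1) (pd r (p l))) => //; exact: cdp.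
- exact: continuous_at_coord.
- by apply: (@continuous_comp _ _ _ (fun z : R * R => u z.1 + z.2 *: v z.1) (p l)) => //; exact: cp.
- by apply: continuous_at_coord; exact: (fstc _ cdv).
Qed.

Lemma variation_continuous : continuous (variation 0).
Proof.
have -> : variation 0 = (fun x => \sum_l ((\sum_r v x 0 r * pd r (p l) (u x)) * derive1 u x 0 l
    + p l (u x) * derive1 v x 0 l)).
  by apply/funext => x; rewrite /variation !scale0r !addr0.
move=> x; apply: continuous_at_sum => l; apply: continuousD; apply: continuousM.
- apply: continuous_at_sum => r; apply: continuousM; first by apply: continuous_at_coord; exact: cv.
  by apply: (continuous_at_comp (@phase_continuous x)); apply: cdp; exact: phase_in.
- by apply: continuous_at_coord; exact: phase_derive_continuous.
- by apply: (continuous_at_comp (@phase_continuous x)); apply: cp; exact: phase_in.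
- by apply: continuous_at_coord; exact: cdv.
Qed.

Lemma variation_support x : a < `|x| -> variation 0 x = 0.
Proof.
move=> ax; rewrite /variation big1 // => l _; rewrite v0 // test_derive0 //.
by rewrite [X in _ + _ * X]mxE mulr0 addr0 big1 ?mul0r // => r _; rewrite mxE mul0r.
Qed.

Lemma line_form_variation :
  L1_derivable (fun s => line_form p (fun x => u x + s *: v x)
                            (fun x => derive1 u x + s *: derive1 v x)) (variation 0).
Proof.
have F0 : line_form p (fun x => u x + 0 *: v x) (fun x => derive1 u x + 0 *: derive1 v x)
    = line_form p u (derive1 u).
  by apply/funext => x; rewrite /line_form; apply: eq_bigr => l _; rewrite !scale0r !addr0.
apply: (@L1_derivable_uniform _ _ _ a) => //.
- exact: variation_continuous.
- exact: variation_support.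
- apply: filterS variation_in => s Us; apply: (@line_form_continuous _ _ _ _) => //.
  + apply: (@derivable_curve_continuous _ (fun x => derive1 u x + s *: derive1 v x)) => x.
    exact: (is_deriveD (phase_derive x) (is_deriveZ s (dv x))).
  + apply: (@derivable_curve_continuous _ (fun x => derive1n 2 u x + s *: derive1n 2 v x)) => x.
    have [su _ _ _] := pu.
    exact: (is_deriveD (smooth_curve_derive 1 x su) (is_deriveZ s (smooth_curve_derive 1 x sv))).
- by rewrite F0; exact: line_form_cint.
- by move=> s x ax; rewrite /line_form v0 // test_derive0 // !scaler0.
apply: uniform_remainder; last exact: variation_continuous.
- move=> x0 _; apply: filterS (variation_near_in x0) => -[x s] /= Us.
  apply: (@is_derive_pairing _ _ p (fun s => u x + s *: v x)
    (fun s => derive1 u x + s *: derive1 v x) s (v x) (derive1 v x)).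
  + by move=> l; exact: C1_diff Us.
  + exact: is_derive_line.
  + exact: is_derive_line.
- by move=> x0 _; exact: variation_cvg_at.
Qed.

(** Cartan's formula: the variation is the x-derivative [q] of p(v) plus the exterior derivative of
    p on (v, u_x), called [T]. Integrating [q] by parts gives the local term - G p(v). *)
Lemma nlform_variation G : cint G ->
  nlform (variation 0) G =
  \int[mu]_x ((\sum_r v x 0 r * line_form (fun l w => pd r (p l) w - pd l (p r) w) u (derive1 u) x)
     * dx_inv G x - G x * line_form p u v x).
Proof.
move=> cG.
pose q x := \sum_l ((\sum_r derive1 u x 0 r * pd r (p l) (u x)) * v x 0 l + p l (u x) * derive1 v x 0 l).
have cqi l x : {for x, continuous (fun x => \sum_r derive1 u x 0 r * pd r (p l) (u x))}.
  apply: continuous_at_sum => r; apply: continuousM.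
    by apply: continuous_at_coord; exact: phase_derive_continuous.
  by apply: (continuous_at_comp (@phase_continuous x)); apply: cdp; exact: phase_in.
have cq : continuous q.
  move=> x; apply: continuous_at_sum => l; apply: continuousD; apply: continuousM => //.
  - by apply: continuous_at_coord; exact: cv.
  - by apply: (continuous_at_comp (@phase_continuous x)); apply: cp; exact: phase_in.
  - by apply: continuous_at_coord; exact: cdv.
have dq x : is_derive x (1 : R) (line_form p u v) (q x).
  apply: (@is_derive_pairing _ _ p u v x (derive1 u x) (derive1 v x)) => //.
  - by move=> l; exact: C1_diff (phase_in x).
  - exact: phase_derive.
have p0 x : a < `|x| -> line_form p u v x = 0.
  by move=> ax; rewrite /line_form big1 // => l _; rewrite v0 // mxE mulr0.
have q0 x : a < `|x| -> q x = 0.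
  by move=> ax; rewrite /q big1 // => l _; rewrite v0 // test_derive0 // mxE !mulr0 addr0.
pose T x := \sum_r v x 0 r * line_form (fun l w => pd r (p l) w - pd l (p r) w) u (derive1 u) x.
have VE : variation 0 = (fun x => q x + T x).
  apply/funext => x; rewrite /variation /q /T /line_form.
  have -> : \sum_r v x 0 r * (\sum_l (pd r (p l) (u x) - pd l (p r) (u x)) * derive1 u x 0 l) =
     \sum_l (\sum_r v x 0 r * pd r (p l) (u x)) * derive1 u x 0 l
     - \sum_l (\sum_r derive1 u x 0 r * pd r (p l) (u x)) * v x 0 l.
    under eq_bigr => r _ do rewrite mulr_sumr.
    under [X in _ = X - _]eq_bigr => l _ do rewrite mulr_suml.
    rewrite [X in _ = X - _]exchange_big -sumrB; apply: eq_bigr => r _ /=.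
    rewrite mulr_suml -sumrB; apply: eq_bigr => l _; ring.
  rewrite scale0r addr0 -sumrB -big_split; apply: eq_bigr => l _ /=.
  rewrite scale0r addr0; ring.
have cT : continuous T.
  have -> : T = (fun x => variation 0 x - q x) by apply/funext => x; rewrite VE; ring.
  by move=> x; apply: continuousB; [exact: variation_continuous|exact: cq].
have T0 x : a < `|x| -> T x = 0.
  by move=> ax; rewrite /T big1 // => r _; rewrite v0 // mxE mul0r.
have ciT := cint_compact_support cT T0; have ciq := cint_compact_support cq q0.
have cip : cint (fun x => G x * line_form p u v x).
  have cl : continuous (line_form p u v) by move=> x; apply/differentiable_continuous/derivable1_diffP; have [] := dq x.
  apply: (@cint_compact_support _ _ a); last by move=> x ax; rewrite p0 // mulr0.
  by move=> x; apply: continuousM; [exact: cG.1|exact: cl].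
rewrite VE nlformDl // (nlform_derivative cG cq dq p0 q0) /nlform addrC -RintegralB //.
  exact/cint_integrable/cint_mul_dx_inv.
exact: cint_integrable.
Qed.

End Variation.
End Curves.

Lemma split_local_terms (R : comPzRingType) (e t1 i1 o2 p1 t2 i2 o1 p2 : R) :
  e * ((t1 * i1 - o2 * p1) + -1 * (t2 * i2 - o1 * p2)) =
  e * (t1 * i1 - t2 * i2) + e * (o1 * p2 - o2 * p1).
Proof. by ring. Qed.

(** * Brackets, their gradients and the Jacobi identity *)

Section Hamiltonian.
Variables (R : realType) (n m : nat) (U : set 'rV[R]_n).
Local Notation mu := (@lebesgue_measure R).
Hypothesis oU : open U.
Variables (eps : 'I_m -> R) (W : 'I_m -> 'rV[R]_n -> 'M[R]_n).
Hypothesis CW : forall a i j, C1_on U (fun v => W a v i j).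
Hypothesis WC : forall a b u, U u -> W a u *m W b u = W b u *m W a u.
Hypothesis WF : forall a b u Y, U u ->
  flow_form (W a) (W b) u Y Y = flow_form (W b) (W a) u Y Y.
Hypothesis WE : forall u i j k h, U u ->
  \sum_a eps a * (W a u i k * W a u j h - W a u i h * W a u j k) = 0.
Local Notation P := (nonlocal_operator eps W).

Lemma pullback_C1 f a k : smooth_on U f -> C1_on U (pullback W f a k).
Proof.
move=> sf; apply: (C1_sum oU) => i; apply: (C1_mul oU) => //.
exact/smooth_C1/smooth_pd.
Qed.

Lemma Rintegral0 : \int[mu]_x (0 : R) = 0.
Proof. by rewrite /Rintegral integral0. Qed.

Lemma Rintegral_sum p (F : 'I_p -> R -> R) : (forall i, cint (F i)) ->
  \int[mu]_x (\sum_i F i x) = \sum_i \int[mu]_x F i x.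
Proof.
move=> cF; elim: p F cF => [|p IH] F cF.
  rewrite big_ord0 -[RHS]Rintegral0.
  by apply: eq_Rintegral => x _; rewrite big_ord0.
rewrite big_ord_recl -IH // -RintegralD //; try exact: cint_integrable.
  by apply: eq_Rintegral => x _; rewrite big_ord_recl.
by apply: cint_integrable; exact: cint_sum.
Qed.

Definition along (a : 'I_m) (u xi : R -> 'rV[R]_n) (x : R) : R :=
  \sum_j hydro (W a) u x 0 j * xi x 0 j.

(** Stated under integrability alone, so that it also serves for bracket gradients and for perturbed
    curves. *)
Lemma pairingE u xi eta : (forall a, cint (along a u xi)) -> (forall a, cint (along a u eta)) ->
  pairing P u xi eta = \sum_a eps a * nlform (along a u xi) (along a u eta).
Proof.
move=> cx ce; rewrite /pairing.
transitivity (\int[mu]_x \sum_a eps a * (along a u xi x * dx_inv (along a u eta) x)).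
  apply: eq_Rintegral => x _; rewrite /along.
  under eq_bigr => i _ do rewrite mxE mulr_sumr.
  rewrite exchange_big /=; apply: eq_bigr => a _.
  rewrite mulr_suml mulr_sumr; apply: eq_bigr => i _; ring.
rewrite Rintegral_sum; last by move=> a; apply/cintZ/cint_mul_dx_inv.
apply: eq_bigr => a _; rewrite RintegralZl //.
exact/cint_integrable/cint_mul_dx_inv.
Qed.

Lemma along_var_density f a u :
  along a u (var_density f u) = line_form (pullback W f a) u (derive1 u).
Proof.
apply/funext => x; rewrite /along /line_form /pullback.
under eq_bigr => j _ do rewrite !mxE mulr_suml.
rewrite exchange_big /=; apply: eq_bigr => k _; rewrite mulr_suml.
by apply: eq_bigr => j _; ring.
Qed.

Section PhasePoint.
Variable u : R -> 'rV[R]_n.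
Hypothesis pu : phase_space U u.

Local Notation om f a := (line_form (pullback W f a) u (derive1 u)).

Lemma density_cint f a : smooth_on U f -> cint (om f a).
Proof.
by move=> sf; apply: (line_form_cint pu) => l w Uw; apply: (C1_cont (pullback_C1 a l sf)).
Qed.

Lemma bracketE f g : smooth_on U f -> smooth_on U g ->
  bracket P f g u = \sum_a eps a * nlform (om f a) (om g a).
Proof.
move=> sf sg; rewrite /bracket pairingE.
- by apply: eq_bigr => a _; rewrite !along_var_density.
- by move=> a; rewrite along_var_density; exact: density_cint.
- by move=> a; rewrite along_var_density; exact: density_cint.
Qed.

Lemma bracket_skew f g : smooth_on U f -> smooth_on U g ->
  bracket P f g u = - bracket P g f u.
Proof.
move=> sf sg; rewrite !bracketE // -sumrN; apply: eq_bigr => a _.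
by rewrite nlform_skew ?mulrN //; exact: density_cint.
Qed.

Definition curl_line f a r : R -> R :=
  line_form (fun l w => curl W f a r l w) u (derive1 u).

Lemma curl_cont f a r l w : smooth_on U f -> U w -> {for w, continuous (curl W f a r l)}.
Proof.
move=> sf Uw; have [_ c1] := pullback_C1 a l sf Uw; have [_ c2] := pullback_C1 a r sf Uw.
exact: (continuousB (c1 r) (c2 l)).
Qed.

(* The local terms of the variational derivative cancel by the identity WE, so only
   the terms with an antiderivative remain. *)
Definition bracket_gradient f g (x : R) : 'rV[R]_n :=
  \row_r \sum_a eps a *
    (curl_line f a r x * dx_inv (om g a) x - curl_line g a r x * dx_inv (om f a) x).

Lemma curl_line_continuous f a r : smooth_on U f -> continuous (curl_line f a r).
Proof.
move=> sf; apply: (line_form_continuous (U := U)).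
- by move=> l w Uw; exact: curl_cont.
- exact: phase_continuous pu.
- exact: phase_derive_continuous pu.
- exact: phase_in pu.
Qed.

Lemma bracket_gradient_coord_continuous f g r : smooth_on U f -> smooth_on U g ->
  continuous (fun x => bracket_gradient f g x 0 r).
Proof.
move=> sf sg x.
have -> : (fun x => bracket_gradient f g x 0 r) = (fun x => \sum_a eps a *
    (curl_line f a r x * dx_inv (om g a) x - curl_line g a r x * dx_inv (om f a) x)).
  by apply/funext => y; rewrite mxE.
apply: continuous_at_sum => a; apply: continuousM; first exact: cst_continuous.
apply: continuousB; apply: continuousM; try exact: curl_line_continuous.
- exact: (dx_inv_continuous (density_cint a sg)).
- exact: (dx_inv_continuous (density_cint a sf)).
Qed.

Lemma bracket_gradient_continuous f g : smooth_on U f -> smooth_on U g ->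
  continuous (bracket_gradient f g).
Proof.
move=> sf sg x; apply/cvgrPdist_le => e e0; near=> y.
rewrite [leLHS]mx_normrE; apply: bigmax_le; first exact: ltW.
have E (A B : 'rV[R]_n) k : (A - B) 0 k = A 0 k - B 0 k by rewrite !mxE.
move=> -[i j] _ /=; rewrite ord1 E.
move: j; near: y; apply: filter_forall => j.
have /cvgrPdist_le H := @bracket_gradient_coord_continuous f g j sf sg x.
exact: H.
Unshelve. all: by end_near. Qed.

Lemma curl_line_bounded f a r : smooth_on U f -> exists M, forall x, `|curl_line f a r x| <= M.
Proof.
by move=> sf; apply: (line_form_bounded pu) => l w Uw; exact: curl_cont.
Qed.

Lemma bracket_gradient_bounded f g r : smooth_on U f -> smooth_on U g ->
  exists M, forall x, `|bracket_gradient f g x 0 r| <= M.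
Proof.
move=> sf sg.
have /choice[M HM] a := curl_line_bounded a r sf.
have /choice[M' HM'] a := curl_line_bounded a r sg.
exists (\sum_a `|eps a| * (M a * L1norm (om g a) + M' a * L1norm (om f a))) => x.
rewrite mxE; apply: le_trans (ler_norm_sum _ _ _) _; apply: ler_sum => a _.
rewrite normrM ler_wpM2l //; apply: le_trans (ler_normB _ _) _.
by apply: lerD; rewrite normrM; apply: ler_pM => //; apply: dx_inv_le; exact: density_cint.
Qed.

(** A product of two factors containing u_x: W_a u_x is integrable and the gradient is bounded. *)
Lemma along_gradient_cint f g a : smooth_on U f -> smooth_on U g ->
  cint (along a u (bracket_gradient f g)).
Proof.
move=> sf sg; apply: cint_sum => j; have [M HM] := bracket_gradient_bounded j sf sg.
apply: (@cint_mulb _ _ _ M) => //; last exact: bracket_gradient_coord_continuous.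
have -> : (fun x => hydro (W a) u x 0 j) = line_form (fun l w => W a w j l) u (derive1 u).
  by apply/funext => x; rewrite mxE.
by apply: (line_form_cint pu) => l w Uw; exact: (C1_cont (CW a j l)).
Qed.

Lemma sum_combine (A S S' : 'I_n -> R) (e I I' : R) :
  \sum_j A j * (e * (S j * I - S' j * I')) =
  e * ((\sum_j A j * S j) * I - (\sum_j A j * S' j) * I').
Proof.
by rewrite !mulr_suml -sumrB mulr_sumr; apply: eq_bigr => j _; ring.
Qed.

Lemma along_gradientE f g b x : along b u (bracket_gradient f g) x =
  \sum_a eps a *
    (curl_form W f a (u x) (derive1 u x *m (W b (u x))^T) (derive1 u x) * dx_inv (om g a) x
   - curl_form W g a (u x) (derive1 u x *m (W b (u x))^T) (derive1 u x) * dx_inv (om f a) x).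
Proof.
rewrite /along; under eq_bigr => j _ do rewrite [bracket_gradient _ _ _ _ _]mxE mulr_sumr.
rewrite exchange_big /=; apply: eq_bigr => a _.
have hydroE j : hydro (W b) u x 0 j = (derive1 u x *m (W b (u x))^T) 0 j.
  by rewrite !mxE; apply: eq_bigr => k _; rewrite mxE mulrC.
under eq_bigr => j _ do rewrite hydroE.
exact: sum_combine.
Qed.

(* Since Q is symmetric, the six families of terms of the Jacobi identity cancel in pairs. *)
Lemma jacobi_sum (Q Q' Q'' : 'I_m -> 'I_m -> R) (A B C : 'I_m -> R) :
  (forall a b, Q a b = Q b a) -> (forall a b, Q' a b = Q' b a) ->
  (forall a b, Q'' a b = Q'' b a) ->
  \sum_b eps b * ((\sum_a eps a * (Q a b * C a - Q' a b * B a)) * A b) +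
  \sum_b eps b * ((\sum_a eps a * (Q' a b * A a - Q'' a b * C a)) * B b) +
  \sum_b eps b * ((\sum_a eps a * (Q'' a b * B a - Q a b * A a)) * C b) = 0.
Proof.
move=> sQ sQ' sQ''.
pose S (q : 'I_m -> 'I_m -> R) (D E : 'I_m -> R) :=
  \sum_b \sum_a eps a * eps b * (q a b * (D a * E b)).
have expand q q' (D E F : 'I_m -> R) :
   \sum_b eps b * ((\sum_a eps a * (q a b * D a - q' a b * E a)) * F b) = S q D F - S q' E F.
  rewrite /S -sumrB; apply: eq_bigr => b _; rewrite mulr_suml mulr_sumr -sumrB.
  apply: eq_bigr => a _; ring.
have swap q D E : (forall a b, q a b = q b a) -> S q D E = S q E D.
  move=> sq; rewrite /S exchange_big /=; apply: eq_bigr => a _; apply: eq_bigr => b _.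
  by rewrite sq; ring.
rewrite !expand (swap Q C A sQ) (swap Q' B A sQ') (swap Q'' C B sQ''); ring.
Qed.

Lemma bracket_jacobi f g h : smooth_on U f -> smooth_on U g -> smooth_on U h ->
  pairing P u (bracket_gradient g h) (var_density f u)
  + pairing P u (bracket_gradient h f) (var_density g u)
  + pairing P u (bracket_gradient f g) (var_density h u) = 0.
Proof.
move=> sf sg sh.
have cG k l b : smooth_on U k -> smooth_on U l -> cint (along b u (bracket_gradient k l)).
  by move=> sk sl; exact: along_gradient_cint.
have cD k b : smooth_on U k -> cint (along b u (var_density k u)).
  by move=> sk; rewrite along_var_density; exact: density_cint.
pose F k l q x := \sum_b eps b * (along b u (bracket_gradient k l) x * dx_inv (om q b) x).
have step k l q : smooth_on U k -> smooth_on U l -> smooth_on U q ->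
    cint (F k l q) /\ pairing P u (bracket_gradient k l) (var_density q u) = \int[mu]_x F k l q x.
  move=> sk sl sq.
  have cF b : cint (fun x => along b u (bracket_gradient k l) x * dx_inv (om q b) x).
    by apply: cint_mul_dx_inv; [exact: cG|exact: density_cint].
  split; first by apply: cint_sum => b; exact: cintZ.
  rewrite pairingE; [|by move=> b; exact: cG|by move=> b; exact: cD].
  rewrite /F Rintegral_sum; last by move=> b; exact: cintZ.
  apply: eq_bigr => b _; rewrite (RintegralZl _ measurableT (cint_integrable (cF b))).
  by rewrite along_var_density.
have [c1 e1] := step g h f sg sh sf; have [c2 e2] := step h f g sh sf sg.
have [c3 e3] := step f g h sf sg sh.
apply: etrans (congr2 +%R (congr2 +%R e1 e2) e3) _.
rewrite -(RintegralD measurableT (cint_integrable c1) (cint_integrable c2)).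
rewrite -(RintegralD measurableT (cint_integrable (cintD c1 c2)) (cint_integrable c3)).
rewrite -[RHS]Rintegral0.
apply: eq_Rintegral => x _; have Ux := phase_in pu x.
pose Q k a b := curl_form W k a (u x) (derive1 u x *m (W b (u x))^T) (derive1 u x).
have FE k l q : F k l q x = \sum_b eps b * ((\sum_a eps a *
    (Q k a b * dx_inv (om l a) x - Q l a b * dx_inv (om k a) x)) * dx_inv (om q b) x).
  by apply: eq_bigr => b _; congr (_ * (_ * _)); exact: along_gradientE.
apply: etrans (congr2 +%R (congr2 +%R (FE g h f) (FE h f g)) (FE f g h)) _.
have dW a i j w : U w -> differentiable (fun v => W a v i j) w by exact: (C1_diff (CW a i j)).
apply: jacobi_sum => a b.
- exact: (curl_form_sym oU dW WC WF sg).
- exact: (curl_form_sym oU dW WC WF sh).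
- exact: (curl_form_sym oU dW WC WF sf).
Qed.

(** The coefficient of d_i f d_j g y^k z^l is the expression antisymmetrized in k and l that [WE]
    annihilates. *)
Lemma bracket_local_terms f g x (z : 'rV[R]_n) :
  \sum_a eps a * (om f a x * (\sum_l pullback W g a l (u x) * z 0 l)
                - om g a x * (\sum_l pullback W f a l (u x) * z 0 l)) = 0.
Proof.
have Ux := phase_in pu x; set y := derive1 u x; set w := u x.
transitivity (\sum_i \sum_j \sum_k \sum_l pd i f w * pd j g w * y 0 k * z 0 l *
   \sum_a eps a * (W a w i k * W a w j l - W a w i l * W a w j k)); last first.
  rewrite big1 // => i _; rewrite big1 // => j _; rewrite big1 // => k _; rewrite big1 // => l _.
  by rewrite WE ?mulr0.
have prod a : om f a x * (\sum_l pullback W g a l (u x) * z 0 l)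
                - om g a x * (\sum_l pullback W f a l (u x) * z 0 l) =
   \sum_i \sum_j \sum_k \sum_l pd i f w * pd j g w * y 0 k * z 0 l *
     (W a w i k * W a w j l - W a w i l * W a w j k).
  have lin q (t : 'rV[R]_n) : \sum_l pullback W q a l w * t 0 l =
      \sum_i pd i q w * \sum_l W a w i l * t 0 l.
    under eq_bigr => l _ do rewrite /pullback mulr_suml.
    rewrite exchange_big /=; apply: eq_bigr => i _; rewrite mulr_sumr.
    by apply: eq_bigr => l _; ring.
  rewrite /line_form -/w -/y !lin [X in _ - X]mulrC !big_distrlr -sumrB /=.
  apply: eq_bigr => i _; rewrite -sumrB; apply: eq_bigr => j _.
  have -> : pd i f w * (\sum_l W a w i l * y 0 l) * (pd j g w * \sum_l W a w j l * z 0 l) -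
      pd i f w * (\sum_l W a w i l * z 0 l) * (pd j g w * \sum_l W a w j l * y 0 l) =
    pd i f w * pd j g w * ((\sum_l W a w i l * y 0 l) * (\sum_l W a w j l * z 0 l)
      - (\sum_l W a w j l * y 0 l) * (\sum_l W a w i l * z 0 l)) by ring.
  rewrite !big_distrlr -sumrB mulr_sumr /=; apply: eq_bigr => k _.
  rewrite -sumrB mulr_sumr; apply: eq_bigr => l _; ring.
under eq_bigr => a _ do rewrite prod mulr_sumr.
rewrite exchange_big; apply: eq_bigr => i _ /=.
under eq_bigr => a _ do rewrite mulr_sumr.
rewrite exchange_big; apply: eq_bigr => j _ /=.
under eq_bigr => a _ do rewrite mulr_sumr.
rewrite exchange_big; apply: eq_bigr => k _ /=.
under eq_bigr => a _ do rewrite mulr_sumr.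
rewrite exchange_big; apply: eq_bigr => l _ /=.
by rewrite mulr_sumr; apply: eq_bigr => a _; ring.
Qed.

Lemma bracket_variation f g : smooth_on U f -> smooth_on U g ->
  is_variational_derivative (bracket P f g) u (bracket_gradient f g).
Proof.
move=> sf sg; split; first exact: bracket_gradient_continuous.
move=> v [sv [a' va']]; pose a := `|a'|.
have a0 : 0 <= a by exact: normr_ge0.
have v0 x : a < `|x| -> v x = 0.
  by move=> ax; apply: va'; apply: le_lt_trans ax; exact: ler_norm.
pose F k b s := line_form (pullback W k b) (fun x => u x + s *: v x)
  (fun x => derive1 u x + s *: derive1 v x).
have F0 k b : F k b 0 = om k b.
  by apply/funext => x; rewrite /F /line_form; apply: eq_bigr => l _; rewrite !scale0r !addr0.
pose dF k b := variation u v (pullback W k b) 0.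
have LD k b : smooth_on U k -> L1_derivable (F k b) (dF k b).
  by move=> sk; apply: (line_form_variation pu sv a0 v0 oU) => l; exact: pullback_C1.
have cF k b : smooth_on U k -> \forall s \near (0 : R), cint (F k b s).
  by move=> sk; have [_ /(_ 1 ltr01)] := LD k b sk; apply: filterS => s [].
(* Membership of u + s v in [phase_space] is not established; integrability of the forms along it,
   supplied by [L1_derivable], is enough to expand the bracket. *)
have brE : \forall s \near (0 : R),
    \sum_b eps b * nlform (F f b s) (F g b s) = bracket P f g (fun x => u x + s *: v x).
  have nf : \forall s \near (0 : R), forall b, cint (F f b s).
    by apply: (@filter_forall R 'I_m (fun b s => cint (F f b s)) (nbhs (0 : R))) => b; exact: cF.
  have ng : \forall s \near (0 : R), forall b, cint (F g b s).
    by apply: (@filter_forall R 'I_m (fun b s => cint (F g b s)) (nbhs (0 : R))) => b; exact: cF.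
  apply: filterS (filterI nf ng) => s [cf cg].
  have FE k b : along b (fun x => u x + s *: v x) (var_density k (fun x => u x + s *: v x)) = F k b s.
    rewrite along_var_density /F; congr line_form.
    by apply/funext => x; rewrite (variation_derive1 pu sv).
  rewrite /bracket pairingE; last 2 first.
  - by move=> b; rewrite FE.
  - by move=> b; rewrite FE.
  by apply: eq_bigr => b _; rewrite !FE.
apply: (near_eq_is_derive brE).
have dsum : is_derive (0 : R) (1 : R) (fun s => \sum_b eps b * nlform (F f b s) (F g b s))
    (\sum_b eps b * (nlform (dF f b) (F g b 0) + nlform (F f b 0) (dF g b))).
  apply: is_derive_sum_fun => b.
  have := is_deriveZ (eps b) (nlform_is_derive (LD f b sf) (LD g b sg)).
  by [].
apply: is_derive_eq dsum _.
have cdF k b : smooth_on U k -> cint (dF k b) by move=> sk; have [] := LD k b sk.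
pose T k b x := \sum_r v x 0 r * curl_line k b r x.
pose p k b := line_form (pullback W k b) u v.
have VE k b G : smooth_on U k -> cint G ->
    nlform (dF k b) G = \int[mu]_x (T k b x * dx_inv G x - G x * p k b x).
  by move=> sk cG; apply: (nlform_variation pu sv v0) => // l; exact: pullback_C1.
have cv : continuous v by exact: (derivable_curve_continuous (fun x => smooth_curve_derive 0 x sv)).
have cT k b : smooth_on U k -> cint (T k b).
  move=> sk; apply: (@cint_compact_support _ _ a); last first.
    by move=> x ax; rewrite /T big1 // => r _; rewrite v0 // mxE mul0r.
  move=> x; apply: continuous_at_sum => r; apply: continuousM.
    by apply: continuous_at_coord; exact: cv.
  exact: curl_line_continuous.
have cp k b : smooth_on U k -> continuous (p k b).
  move=> sk; apply: (line_form_continuous (U := U)) => //.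
  - by move=> l w Uw; apply: (C1_cont (pullback_C1 b l sk)).
  - exact: phase_continuous pu.
  - exact: phase_in pu.
have cGp k l b : smooth_on U k -> smooth_on U l -> cint (fun x => om k b x * p l b x).
  move=> sk sl; apply: (@cint_compact_support _ _ a); last first.
    move=> x ax; have -> : p l b x = 0; last by rewrite mulr0.
    by rewrite /p /line_form big1 // => r _; rewrite v0 // mxE mulr0.
  by move=> x; apply: continuousM; [exact: (density_cint b sk).1|exact: cp].
have cI k l b : smooth_on U k -> smooth_on U l ->
    cint (fun x => T k b x * dx_inv (om l b) x - om l b x * p k b x).
  move=> sk sl; have c1 := cint_mul_dx_inv (cT k b sk) (density_cint b sl).
  have c2 := cintZ (-1) (cGp l k b sl sk).
  have -> : (fun x => T k b x * dx_inv (om l b) x - om l b x * p k b x) =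
     (fun x => T k b x * dx_inv (om l b) x + -1 * (om l b x * p k b x)).
    by apply/funext => x; ring.
  exact: cintD.
transitivity (\int[mu]_x \sum_b eps b *
    ((T f b x * dx_inv (om g b) x - om g b x * p f b x)
     + -1 * (T g b x * dx_inv (om f b) x - om f b x * p g b x))).
  rewrite Rintegral_sum; last by move=> b; apply/cintZ/cintD; [exact: cI|apply/cintZ/cI].
  apply: eq_bigr => b _; rewrite RintegralZl //; last first.
    by apply/cint_integrable/cintD; [exact: cI|apply/cintZ/cI].
  rewrite RintegralD //; last 2 first.
  - exact/cint_integrable/cI.
  - exact/cint_integrable/cintZ/cI.
  rewrite RintegralZl //; last exact/cint_integrable/cI.
  (* Skewness brings the variation of g to the left argument, where [nlform_variation] applies; this
     is the origin of the factor -1. *)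
  rewrite !F0 (nlform_skew (density_cint b sf) (cdF g b sg)).
  by rewrite !VE ?mulN1r //; exact: density_cint.
apply: eq_Rintegral => x _.
have loc := bracket_local_terms f g x (v x).
transitivity (\sum_b eps b * (T f b x * dx_inv (om g b) x - T g b x * dx_inv (om f b) x)).
  rewrite -[RHS]addr0 -[X in _ = _ + X]loc -big_split; apply: eq_bigr => b _ /=.
  exact: split_local_terms.
under [RHS]eq_bigr => r _ do rewrite mxE mulr_suml.
rewrite [RHS]exchange_big; apply: eq_bigr => b _ /=.
rewrite /T -sum_combine; apply: eq_bigr => r _; exact: mulrC.
Qed.

End PhasePoint.

Lemma nonlocal_operator_hamiltonian : hamiltonian P U.
Proof.
split=> [f g u sf sg pu|f g h u sf sg sh pu]; first exact: bracket_skew.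
exists (bracket_gradient u g h), (bracket_gradient u h f), (bracket_gradient u f g).
by split; [exact: bracket_variation..|exact: bracket_jacobi].
Qed.

End Hamiltonian.

(** * The frame hypotheses for the given systems *)

Section SemisimpleSystems.
Variables (R : realType) (n m : nat) (U : set 'rV[R]_n).
Variables (c : 'I_n -> 'I_n -> 'I_n -> 'rV[R]_n -> R).
Variables (X : 'I_m -> 'rV[R]_n -> 'rV[R]_n) (eps : 'I_m -> R).
Let W (a : 'I_m) : 'rV[R]_n -> 'M[R]_n := affinor_of c (X a).
Let g (u : 'rV[R]_n) : 'M[R]_n := \sum_(a < m) eps a *: ((X a u)^T *m X a u).
Hypothesis oU : open U.
Hypothesis sc : forall i j k, smooth_on U (c i j k).
Hypothesis sX : forall a, smooth_vfield U (X a).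
Hypothesis WW : forall a b, commuting_flows U (W a) (W b).
Hypothesis gU : forall u, U u -> g u \in unitmx.
Hypothesis gc : forall u i k p, U u ->
  \sum_l g u k l * c i l p u = \sum_l g u i l * c k l p u.
Variable Z : 'I_n -> 'rV[R]_n -> 'rV[R]_n.
Hypothesis sZ : forall a, smooth_vfield U (Z a).
Hypothesis ZP : forall u, U u -> idempotent_basis c u (Z ^~ u).
Hypothesis ZL : forall a b u, U u -> lie_bracket (Z a) (Z b) u = 0.

Lemma affinor_C1 a i j : C1_on U (fun v => W a v i j).
Proof.
have -> : (fun v => W a v i j) = (fun v => \sum_k c i j k v * X a v 0 k).
  by apply/funext => v; rewrite mxE.
by apply: (C1_sum oU) => k; apply: (C1_mul oU); apply: smooth_C1; [exact: sc|exact: sX].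
Qed.

Lemma affinor_diff a i j u : U u -> differentiable (fun v => W a v i j) u.
Proof. exact: (C1_diff (affinor_C1 a i j)). Qed.

Lemma metric_sym v : (g v)^T = g v.
Proof.
rewrite /g linear_sum; apply: eq_bigr => a _.
by rewrite linearZ /= trmx_mul trmxK.
Qed.

Lemma vfield_pderivable a u j : U u -> pderivable (fun v => X a v 0 j) u.
Proof. by move=> Uu; apply: diff_pderivable; exact: (sX a j [::]). Qed.

Lemma metric_entries_pderivable u : U u -> mx_pderivable g u.
Proof.
move=> Uu i j.
have -> : (fun v => g v i j) = (fun v => \sum_a eps a * (X a v 0 i * X a v 0 j)).
  by apply/funext => v; rewrite summxE; apply: eq_bigr => a _; rewrite !mxE big_ord1 !mxE.
apply: pderivable_sum => a; apply: pderivableM; first exact: pderivable_cst.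
by apply: pderivableM; exact: vfield_pderivable.
Qed.

Let E (u : 'rV[R]_n) : 'M[R]_n := \matrix_a Z a u.

Lemma frame_unit u : U u -> E u \in unitmx.
Proof. by move=> Uu; have [] := ZP Uu. Qed.

Lemma frame_pderivable a u : U u -> mx_pderivable (Z a) u.
Proof. by move=> Uu i j; rewrite ord1; apply: diff_pderivable; exact: (sZ a j [::]). Qed.

(** The component of [X a] on the idempotent [Z b], hence the eigenvalue of multiplication by [X a]
    on [Z b]. *)
Definition eigenvalue_fun (a : 'I_m) (b : 'I_n) (u : 'rV[R]_n) : R :=
  (X a u *m invmx (E u)) 0 b.

Lemma eigenvalue_pderivable a b u : U u -> pderivable (eigenvalue_fun a b) u.
Proof.
move=> Uu; have -> : eigenvalue_fun a b = (fun v => \sum_j X a v 0 j * invmx (E v) j b).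
  by apply/funext => v; rewrite /eigenvalue_fun mxE.
apply: pderivable_sum => j; apply: pderivableM; first exact: vfield_pderivable.
apply: (@pderivable_invmx _ _ U _ E u j b oU Uu) => [v|i k]; first exact: frame_unit.
have -> : (fun v => E v i k) = (fun v => Z i v 0 k) by apply/funext => v; rewrite mxE.
exact: (@frame_pderivable i u Uu 0 k).
Qed.

Lemma vfield_frame a u : U u -> X a u = \sum_b eigenvalue_fun a b u *: Z b u.
Proof.
move=> Uu; rewrite -[LHS](mulmxKV (frame_unit Uu)) mulmx_sum_row.
by apply: eq_bigr => b _; rewrite rowK.
Qed.

Lemma frame_commute a b u : U u -> dirmx (Z b) u (Z a u) = dirmx (Z a) u (Z b u).
Proof.
move=> Uu; apply/matrixP => i j; rewrite ord1 !mxE; apply/eqP; rewrite -subr_eq0; apply/eqP.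
have := congr1 (fun r : 'rV[R]_n => r 0 j) (ZL a b Uu).
by rewrite !mxE sumrB.
Qed.

Lemma gram_orthogonal a b u : U u -> a != b -> gram g Z a b u = 0.
Proof.
move=> Uu ab; rewrite /gram (frame_orthogonal (ZP Uu) (metric_sym u) (gU Uu) _ ab) ?mxE //.
by move=> i k p; exact: gc.
Qed.

(** [M] is the contravariant metric in the frame, which the definition of g expresses by the
    eigenvalues; it is inverse to the Gram matrix [K], and since [K] is diagonal each entry of M K
    is a single product. *)
Lemma eigenvalue_gram a b u : U u ->
  \sum_e eps e * (eigenvalue_fun e a u * eigenvalue_fun e b u) * gram g Z b b u = (a == b)%:R.
Proof.
move=> Uu; have EU := frame_unit Uu.
pose K := E u *m invmx (g u) *m (E u)^T.
pose M := (invmx (E u))^T *m g u *m invmx (E u).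
have KE i j : K i j = gram g Z i j u.
  rewrite /K /gram -!mulmxA !mxE; apply: eq_bigr => k _; rewrite !mxE; congr (_ * _).
  by apply: eq_bigr => l _; rewrite !mxE.
have MK : M *m K = 1%:M.
  rewrite /M /K !mulmxA -[_ *m invmx (E u) *m E u]mulmxA mulVmx // mulmx1.
  by rewrite -[_ *m g u *m _]mulmxA mulmxV ?gU // mulmx1 -trmx_mul mulmxV // trmx1.
have ME : M a b = \sum_e eps e * (eigenvalue_fun e a u * eigenvalue_fun e b u).
  rewrite /M /g mulmx_sumr mulmx_suml summxE; apply: eq_bigr => e _.
  rewrite -scalemxAr -scalemxAl mxE; congr (_ * _).
  have -> : (invmx (E u))^T *m ((X e u)^T *m X e u) *m invmx (E u) =
      (X e u *m invmx (E u))^T *m (X e u *m invmx (E u)) by rewrite trmx_mul !mulmxA.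
  by rewrite mxE big_ord1 mxE.
rewrite -mulr_suml -ME -KE; have := congr1 (fun A : 'M[R]_n => A a b) MK.
rewrite [RHS]mxE mxE => <-; rewrite (bigD1 b) //= big1 ?addr0 // => k kb.
by rewrite KE gram_orthogonal // mulr0.
Qed.

Lemma affinor_metric a u : U u -> (W a u)^T *m invmx (g u) = invmx (g u) *m W a u.
Proof.
move=> Uu; apply: (metric_mul_affinor_sym (X a) (metric_sym u) (gU Uu)).
by move=> i k p; exact: gc.
Qed.

Lemma affinor_flow a b u Y Y' : U u ->
  flow_form (W a) (W b) u Y Y' + flow_form (W a) (W b) u Y' Y =
  flow_form (W b) (W a) u Y Y' + flow_form (W b) (W a) u Y' Y.
Proof.
move=> Uu; apply: (flow_form_polarized oU _ _ (WW a b)) => //.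
- by move=> w i j; exact: affinor_diff.
- by move=> w i j; exact: affinor_diff.
Qed.

Lemma nabla_semisimple a u i j k : U u -> nabla g (W a) k i j u = nabla g (W a) j i k u.
Proof.
move=> Uu; apply: (nabla_affinor_sym metric_sym oU gU metric_entries_pderivable
  frame_pderivable frame_unit frame_commute _ eigenvalue_pderivable _ affinor_metric
  gram_orthogonal eigenvalue_gram) => //.
- by move=> e w Uw r l; apply: diff_pderivable; exact: affinor_diff.
- by move=> e b w Uw; exact: (affinor_frame (ZP Uw) b (vfield_frame e Uw)).
- by move=> e f w b b' Uw; exact: affinor_flow.
Qed.

End SemisimpleSystems.

Theorem theorem1 (R : realType) (n m : nat) (U : set 'rV[R]_n)
  (c : 'I_n -> 'I_n -> 'I_n -> 'rV[R]_n -> R)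
  (X : 'I_m -> 'rV[R]_n -> 'rV[R]_n) (eps : 'I_m -> R) :
  let W (a : 'I_m) : 'rV[R]_n -> 'M[R]_n := affinor_of c (X a) in
  let g (u : 'rV[R]_n) : 'M[R]_n :=
    \sum_(a < m) eps a *: ((X a u)^T *m X a u) in
  open U ->
  (forall i j k, smooth_on U (c i j k)) ->
  associative_on c U ->
  semisimple_on c U ->
  holonomic_idempotents c U ->
  (forall a, smooth_vfield U (X a)) ->
  (forall a b, commuting_flows U (W a) (W b)) ->
  (forall a, eps a = 1 \/ eps a = -1) ->
  (forall u, U u -> g u \in unitmx) ->
  (forall u i k p, U u ->
     \sum_l g u k l * c i l p u = \sum_l g u i l * c k l p u) ->
  (* 1 *)
  (forall a u, U u ->
     (forall i j, \sum_k invmx (g u) i k * W a u k j =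
                  \sum_k invmx (g u) j k * W a u k i) /\
     (forall i j k, nabla g (W a) k i j u = nabla g (W a) j i k u)) /\
  (* 2 (a) *)
  (forall a b u k l q, U u ->
     let pdW (d : 'I_m) (p i j : 'I_n) : R := pd p (fun v => W d v i j) u in
     \sum_p (W b u p q * pdW a p k l + W b u p l * pdW a p k q
             + W a u k p * pdW b l p q + W a u k p * pdW b q p l) =
     \sum_p (W a u p q * pdW b p k l + W a u p l * pdW b p k q
             + W b u k p * pdW a l p q + W b u k p * pdW a q p l)) /\
  (* 2 (b) *)
  (forall a b u, U u -> W a u *m W b u - W b u *m W a u = 0) /\
  (* 2 (c) *)
  (forall u i j k h, U u ->
     \sum_a eps a * (W a u i k * W a u j h - W a u i h * W a u j k) = 0) /\
  hamiltonian (nonlocal_operator eps W) U.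
Proof.
move=> W g oU sc _ _ [Z [sZ ZP ZL]] sX WW _ gU gc.
have gT := metric_sym X eps.
have dW a i j u : U u -> differentiable (fun v => W a v i j) u.
  exact: (affinor_diff oU sc sX).
have WC a b u : U u -> W a u *m W b u = W b u *m W a u.
  by move=> Uu; exact: (affinors_commute (ZP u Uu)).
have WE u i j k h : U u ->
    \sum_a eps a * (W a u i k * W a u j h - W a u i h * W a u j k) = 0.
  move=> Uu; apply: (affinor_bivector (ZP u Uu) i j k h (gT u)).
  by move=> i' k' p; exact: gc.
have WF a b u Y : U u -> flow_form (W a) (W b) u Y Y = flow_form (W b) (W a) u Y Y.
  by move=> Uu; apply: (flow_form_diag oU _ _ (WW a b)) => // w r l; exact: dW.
split; [|split; [|split; [|split]]].
- move=> a u Uu; split; last first.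
    by move=> i j k; exact: (nabla_semisimple oU sc sX WW gU gc sZ ZP ZL).
  move=> i j; have H := affinor_metric gU gc a Uu.
  have := congr1 (fun M : 'M[R]_n => M j i) H; rewrite !mxE => <-.
  have giS k l : invmx (g u) k l = invmx (g u) l k by rewrite -{1}(invmx_sym gT u) mxE.
  by apply: eq_bigr => k _; rewrite giS mulrC [in RHS]mxE.
- move=> a b u k l q Uu; apply: (flow_identity oU _ _ (WW a b)) => // w r p; exact: dW.
- by move=> a b u Uu; rewrite WC // subrr.
- exact: WE.
- apply: (nonlocal_operator_hamiltonian oU _ WC WF WE) => a i j.
  exact: (affinor_C1 oU sc sX).
Qed.
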